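(* Let $m>1$ and let $(V_\delta,R_\delta,\sigma_\delta)_{0<\delta<1}$ be a high-energy family of solitary waves (as defined in the context) with associated parameters $\varepsilon_\delta,\mu_\delta$. The relation between $\mu_\delta$ and $\varepsilon_\delta$ is determined up to error terms of order $O(\varepsilon_\delta^{m+1})$, and the relation between $\delta$ and $\varepsilon_\delta$ up to order $O(\varepsilon_\delta^m)$; that is, as $\delta\to0$, $$\mu_\delta=\frac{\bar\mu\,\varepsilon_\delta}{1+\varepsilon_\delta(\bar\kappa-1)}+O(\varepsilon_\delta^{m+1}),\qquad \delta=1-\sqrt{\big(1+\varepsilon_\delta(\bar\kappa-1)\big)\Big(1-\varepsilon_\delta\Big(1+\frac{\bar\eta}{\bar\mu}\Big)\Big)}+O(\varepsilon_\delta^m).$$ In particular, as $\delta\to0$, $$\mu_\delta=\bar\mu\,\varepsilon_\delta+\bar\mu(1-\bar\kappa)\,\varepsilon_\delta^2+o(\varepsilon_\delta^2),\qquad \sigma_\delta=\bar\mu^2\varepsilon_\delta^{-m}+2\bar\mu^2(1-\bar\kappa)\,\varepsilon_\delta^{-m+1}+o(\varepsilon_\delta^{-m+1})$$ for all $m>1$, and, provided that $m>2$, $$\delta=\frac{2\bar\mu-\bar\mu\,\bar\kappa+\bar\eta}{2\bar\mu}\,\varepsilon_\delta+\frac{\bar\mu^2\bar\kappa^2+\bar\eta^2+2\bar\mu\,\bar\kappa\,\bar\eta}{8\bar\mu^2}\,\varepsilon_\delta^2+o(\varepsilon_\delta^2).$$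
   Context: Fix $m\in(1,\infty)$ and $\Phi(r)=\frac{1}{m(m+1)}\big((1-r)^{-m}-mr-1\big)$ for $r<1$. For $V\in L^2(\mathbb R)$ let $(AV)(x)=\int_{x-1/2}^{x+1/2}V(y)\,dy$. A solitary wave is a triple $(V,R,\sigma)$ with $\sigma>0$ satisfying $R=AV$ and $\sigma V=A\Phi'(R)$ on $\mathbb R$ (equivalently, for $V\in L^2$, $R'(x)=V(x+\frac12)-V(x-\frac12)$ and $\sigma V'(x)=\Phi'(R(x+\frac12))-\Phi'(R(x-\frac12))$ for all $x\in\mathbb R$). A function is unimodal if it is increasing for negative $x$ and decreasing for positive $x$. A high-energy family is a family $(V_\delta,R_\delta,\sigma_\delta)_{0<\delta<1}$ of solitary waves such that (i) $V_\delta,R_\delta\in L^2(\mathbb R)\cap BC^1(\mathbb R)$ are nonnegative, even and unimodal; (ii) $\|V_\delta\|_2=1-\delta$ and $R_\delta$ takes values in $[0,1)$; (iii) $p_\delta:=\int_{\mathbb R}\Phi(R_\delta(x))\,dx\to+\infty$ as $\delta\to0$. Its parameters are $\varepsilon_\delta:=1-R_\delta(0)$ and $\mu_\delta:=\sqrt{\sigma_\delta\,\varepsilon_\delta^{m+2}}$. $\tilde S_0:\mathbb R\to\mathbb R$ is the solution of $\tilde S_0''=\frac{2}{m+1}\,(1+\tilde S_0)^{-(m+1)}$, $\tilde S_0(0)=\tilde S_0'(0)=0$; $\bar\mu:=\frac{2}{\sqrt{m(m+1)}}$, $\bar\kappa:=\int_0^\infty\tilde x\,\tilde S_0''(\tilde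 x)\,d\tilde x$, $\bar\eta:=\int_0^\infty\tilde S_0(\tilde x)\,\tilde S_0''(\tilde x)\,d\tilde x$ (convergent integrals). $O(\varepsilon_\delta^k)$ denotes a quantity bounded in absolute value by $C\varepsilon_\delta^k$ with $C$ independent of $\delta$; $o(\varepsilon_\delta^k)$ is meant as $\delta\to0$ (where $\varepsilon_\delta\to0$). *)

(* Defs.v *)
From mathcomp Require Export all_boot all_order all_algebra.
From mathcomp Require Export all_classical all_reals all_analysis.
Export Order.TTheory GRing.Theory Num.Theory.
Export numFieldNormedType.Exports.

Set Implicit Arguments.
Unset Strict Implicit.
Unset Printing Implicit Defensive.

Local Open Scope ring_scope.
Local Open Scope classical_set_scope.

Section Functions.
Context {R : realType}.
Implicit Types f : R -> R.

Definition inL2 f : Prop := f \in Lfun (@lebesgue_measure R) 2%:E.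

Definition isBC1 f : Prop :=
  [/\ forall x, derivable f x 1, continuous f^`(),
      bounded_fun f & bounded_fun f^`()].

Definition nonneg_fun f : Prop := forall x, 0 <= f x.

Definition even_fun f : Prop := forall x, f (- x) = f x.

(* Monotonicity is meant in the non-strict sense. *)
Definition unimodal f : Prop :=
  (forall x y, x <= y -> y < 0 -> f x <= f y) /\
  (forall x y, 0 < x -> x <= y -> f y <= f x).

End Functions.

Section SolitaryWaves.
Context {R : realType}.
Implicit Types (m sigma : R) (V S : R -> R).

(* Only the values at r < 1 are meaningful. *)
Definition Phi m (r : R) : R :=
  (m * (m + 1))^-1 * ((1 - r) `^ (- m) - m * r - 1).

Definition avg V (x : R) : R :=
  \int[@lebesgue_measure R]_(y in `[x - 2^-1, x + 2^-1]) V y.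

Record solitary_wave m V (Rw : R -> R) sigma : Prop := SolitaryWave {
  sw_sigma_gt0 : 0 < sigma ;
  sw_L2 : inL2 V ;
  sw_lt1 : forall x, Rw x < 1 ;
  sw_avg : forall x, Rw x = avg V x ;
  sw_eq : forall x, sigma * V x = avg (fun y => (Phi m)^`() (Rw y)) x }.

Definition potential_energy m (Rw : R -> R) : \bar R :=
  (\int[@lebesgue_measure R]_x (Phi m (Rw x))%:E)%E.

(* The family is indexed by all reals, but only its members at
   0 < delta < 1 are constrained. *)
Record high_energy_family m (V Rw : R -> R -> R) (sigma : R -> R) : Prop :=
  HighEnergyFamily {
  hef_wave : forall d, 0 < d < 1 -> solitary_wave m (V d) (Rw d) (sigma d) ;
  hef_V : forall d, 0 < d < 1 ->
    [/\ inL2 (V d), isBC1 (V d), nonneg_fun (V d), even_fun (V d)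
      & unimodal (V d)] ;
  hef_R : forall d, 0 < d < 1 ->
    [/\ inL2 (Rw d), isBC1 (Rw d), nonneg_fun (Rw d), even_fun (Rw d)
      & unimodal (Rw d)] ;
  hef_norm : forall d, 0 < d < 1 ->
    ('N[@lebesgue_measure R]_2%:E [EFin \o V d] = (1 - d)%:E)%E ;
  hef_range : forall d, 0 < d < 1 -> forall x, 0 <= Rw d x < 1 ;
  hef_energy : potential_energy m (Rw d) @[d --> 0^'+] --> +oo%E }.

Definition eps_of (Rw : R -> R -> R) (d : R) : R := 1 - Rw d 0.

Definition mu_of m (Rw : R -> R -> R) (sigma : R -> R) (d : R) : R :=
  Num.sqrt (sigma d * eps_of Rw d `^ (m + 2)).

(* [-1 < S x] keeps the base of the real power in the right-hand side
   positive. *)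
Record limit_profile m S : Prop := LimitProfile {
  lp_gtN1 : forall x, -1 < S x ;
  lp_derivable : forall x, derivable S x 1 ;
  lp_derivable2 : forall x, derivable S^`() x 1 ;
  lp_ode : forall x, S^`(2) x = 2 / (m + 1) * (1 + S x) `^ (- (m + 1)) ;
  lp_init : S 0 = 0 ;
  lp_init' : S^`() 0 = 0 }.

Definition mu_bar m : R := 2 / Num.sqrt (m * (m + 1)).

Definition kappa_bar S : R :=
  \int[@lebesgue_measure R]_(x in `[0, +oo[) (x * (S^`(2))%classic x).

Definition eta_bar S : R :=
  \int[@lebesgue_measure R]_(x in `[0, +oo[) (S x * (S^`(2))%classic x).

End SolitaryWaves.

(* Main.v *)
(** Near the origin the gap [Q := 1 - R] solves
    [sigma Q'' = 2 Phi'(R) - Phi'(R(. + 1)) - Phi'(R(. - 1))], where the last two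
    terms stay bounded because [R <= 3/4] on [1/2, +oo).  Hence the energy
    [Q' ^ 2 - (mub ^ 2 / sigma) (eps ^ -m - Q ^ -m)] is conserved up to a relative
    error [O(eps ^ m)], so that [Q = eps (1 + S tau)] with [tau'] within a factor
    [1 + O(eps ^ m)] of [b / eps], [b := (eps ^ -m / sigma) ^ (1/2) = eps / mu].
    With [a := mub b], the asymptotics of [S] at infinity give at [x = 1/2]
      [Q(1/2) = eps + a / 2 - eps kappa],  [Q'(1/2) = a]  and
      [int_0^(1/2) Q' ^ 2 = a ^ 2 / 2 - a eps (kappa + eta / mub)]
    up to [O(eps ^ m)].  On the other hand [V (1/2 + y) + V (1/2 - y)] is constant
    up to [O(1 / sigma) = O(eps ^ m)] on [0, 1/2] and [V] is small beyond [1].  So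
    [R(1/2) = V(0) / 2], [Q'(1/2) = V(0)] and
    [int V ^ 2 = V(0) ^ 2 / 2 + int_0^(1/2) Q' ^ 2], again up to [O(eps ^ m)].
    Matching the two gives [a = 1 + eps (kappa - 1)] and
    [(1 - delta) ^ 2 = a (a - eps (kappa + eta / mub))] up to [O(eps ^ m)]; all
    expansions follow. *)

Require Import Defs.
From mathcomp Require Import measurable_realfun ring lra.
Set Implicit Arguments.
Unset Strict Implicit.
Unset Printing Implicit Defensive.
Local Open Scope ring_scope.
Local Open Scope classical_set_scope.

(** Two obstacles shape the proof. First, the estimates feed on each other: [1 / sigma] counts as
    [O(eps ^ m)] only once [b] is bounded above, that bound needs the asymptotics of [S] at a time
    of order [1 / eps], and for the time to be so large [b] must be bounded below. The circle is
    opened by facts free of [sigma]: [R(0) = 1 - eps] and [int V ^ 2 <= 1] make Cauchy-Schwarz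
    nearly sharp on [-1/2, 1/2], so [V] has little mass outside; for [eps <= 1/8] this gives
    [R <= 3/4] on [1/2, +oo) and [V(0) - V(1) >= 1/4]. Second, [Q'] and [S'] vanish at 0, where an
    additive energy error could not be carried through a square root; being proportional to
    [Q - eps], the error is absorbed in a factor [1 - k]. For the same reason the inverse of [S] is
    differentiated only at positive arguments, and the comparison starts at a small [x > 0] that is
    then sent to 0. That [eps -> 0] at all follows from [p <= eps ^ -(m + 2)]. Apart from [kappa]
    and [eta], integrals are handled as primitives, compared through their derivatives. *)

Section Calculus.
Context {R : realType}.
Implicit Types (f g F : R -> R) (a b c l x : R).

Lemma derive_cst c x : is_derive x 1 (fun _ : R => c) 0.
Proof. exact: is_derive_cst. Qed.

Lemma derive_id x : is_derive x 1 (fun t : R => t) 1.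
Proof. exact: is_derive_id. Qed.

Lemma derive_add f g a b x : is_derive x 1 f a -> is_derive x 1 g b ->
  is_derive x 1 (fun t => f t + g t) (a + b).
Proof. by move=> df dg; apply: is_deriveD. Qed.

Lemma derive_opp f a x : is_derive x 1 f a -> is_derive x 1 (fun t => - f t) (- a).
Proof. by move=> df; apply: is_deriveN. Qed.

Lemma derive_mul f g a b x : is_derive x 1 f a -> is_derive x 1 g b ->
  is_derive x 1 (fun t => f t * g t) (a * g x + f x * b).
Proof.
move=> df dg; have /is_derive_eq := is_deriveM df dg; apply.
by rewrite /GRing.scale/= addrC (mulrC (g x)).
Qed.

Lemma derive_sqr f a x : is_derive x 1 f a ->
  is_derive x 1 (fun t => f t ^+ 2) (2 * f x * a).
Proof.
move=> df; have := derive_mul df df.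
by under eq_fun do rewrite -expr2; move/is_derive_eq; apply; ring.
Qed.

Lemma derive_comp f g a b x : is_derive (g x) 1 f a -> is_derive x 1 g b ->
  is_derive x 1 (fun t => f (g t)) (a * b).
Proof. exact: is_derive1_comp. Qed.

Lemma derive_powR f a p x : is_derive x 1 f a -> 0 < f x ->
  is_derive x 1 (fun t => f t `^ p) (p * f x `^ (p - 1) * a).
Proof. by move=> df fx; apply: (derive_comp (is_derive1_powR p fx)). Qed.

Lemma is_derive_continuous f a x : is_derive x 1 f a -> {for x, continuous f}.
Proof. by move=> [df _]; apply/differentiable_continuous/derivable1_diffP. Qed.

Lemma is_derive_derivable f x : derivable f x 1 -> is_derive x 1 f (f^`() x).
Proof. by move=> df; rewrite derive1E; apply: derivableP. Qed.

Lemma is_derive_derive1 f a x : is_derive x 1 f a -> f^`() x = a.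
Proof. by move=> [_ <-]; rewrite derive1E. Qed.

Lemma eq_is_derive f g a x : is_derive x 1 f a -> f =1 g -> is_derive x 1 g a.
Proof. by move=> df /funext <-. Qed.

Lemma derive_le f (f' : R -> R) a b : a <= b ->
  (forall x, a <= x <= b -> is_derive x 1 f (f' x)) ->
  (forall x, a < x < b -> 0 <= f' x) -> f a <= f b.
Proof.
rewrite le_eqVlt => /predU1P[->//|ab] df f'0.
have [||c] := @MVT R f f' a b ab.
- by move=> x; rewrite in_itv/= => /andP[ax xb]; apply: df; rewrite !ltW.
- apply: derivable_within_continuous => x; rewrite in_itv/= => /df[//].
rewrite in_itv/= => /f'0 c0 E.
by rewrite -subr_ge0 E mulr_ge0// subr_ge0 ltW.
Qed.

Lemma derive_lt f (f' : R -> R) a b : a < b ->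
  (forall x, a <= x <= b -> is_derive x 1 f (f' x)) ->
  (forall x, a < x < b -> 0 < f' x) -> f a < f b.
Proof.
move=> ab df f'0.
have [||c] := @MVT R f f' a b ab.
- by move=> x; rewrite in_itv/= => /andP[ax xb]; apply: df; rewrite !ltW.
- apply: derivable_within_continuous => x; rewrite in_itv/= => /df[//].
rewrite in_itv/= => /f'0 c0 E.
by rewrite -subr_gt0 E mulr_gt0// subr_gt0.
Qed.

(** Plays the role of integrating [f' <= g'] over [a, b]. The comparison is asked only on the open
    interval, so bounds known strictly inside suffice. *)
Lemma derive_cmp f g (f' g' : R -> R) a b : a <= b ->
  (forall x, a <= x <= b -> is_derive x 1 f (f' x)) ->
  (forall x, a <= x <= b -> is_derive x 1 g (g' x)) ->
  (forall x, a < x < b -> f' x <= g' x) -> f b - f a <= g b - g a.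
Proof.
move=> ab df dg fg.
suff : g a + - f a <= g b + - f b by lra.
apply: (derive_le (f := fun t => g t + - f t) (f' := fun t => g' t + - f' t)) => //.
  by move=> x /[dup]/df ? /dg ?; apply: derive_add => //; apply: derive_opp.
by move=> x /fg; lra.
Qed.

Lemma derive_eq f g (h : R -> R) :
  (forall x, is_derive x 1 f (h x)) -> (forall x, is_derive x 1 g (h x)) ->
  forall a b, f b - f a = g b - g a.
Proof.
move=> df dg a b.
have := @is_derive_0_is_cst R (fun t => f t + - g t) a b.
move=> E; suff : f a + - g a = f b + - g b by lra.
apply: E => x; have /is_derive_eq := derive_add (df x) (derive_opp (dg x)); apply.
by rewrite subrr.
Qed.

End Calculus.

(** * Primitives of continuous functions, and integrals expressed by them *)

Section Primitives.
Context {R : realType}.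
Implicit Types (f F : R -> R) (a b x : R).

Lemma continuous_integral_primitive f F a b : a < b -> continuous f ->
  (forall x, is_derive x 1 F (f x)) ->
  \int[@lebesgue_measure R]_(y in `[a, b]) f y = F b - F a.
Proof.
move=> ab cf dF.
rewrite /Rintegral (@continuous_FTC2 R f F a b) ?EFinN//.
- exact: continuous_subspaceT.
- split.
  + by move=> x _; case: (dF x).
  + exact/cvg_at_right_filter/(is_derive_continuous (dF a)).
  + exact/cvg_at_left_filter/(is_derive_continuous (dF b)).
- by move=> x _; apply: is_derive_derive1.
Qed.

Lemma continuous_primitive f : continuous f ->
  exists F, F 0 = 0 /\ forall x, is_derive x 1 F (f x).
Proof.
move=> cf.
have int a b : (@lebesgue_measure R).-integrable `[a, b] (EFin \o f).
  apply: continuous_compact_integrable; first exact: segment_compact.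
  exact: continuous_subspaceT.
pose I a x := \int[@lebesgue_measure R]_(t in `[a, x]) f t.
have dI a x : a < x -> is_derive x 1 (I a) (f x).
  move=> ax; have xx1 : x < x + 1 by rewrite ltrDl.
  have [dx <-] := continuous_FTC1_closed xx1 (int a (x + 1)) ax (cf x).
  exact: is_derive_derivable.
(* The base point moves left with [x]; the value at [0] renormalizes. *)
have base a b x : a < b -> b < x -> b < 0 -> I a x - I a 0 = I b x - I b 0.
  move=> ab bx b0.
  have dab y : b < y -> is_derive y 1 (fun t => I a t + - I b t) 0.
    move=> bY; have da := dI _ _ (lt_trans ab bY); have db := dI _ _ bY.
    by have /is_derive_eq := derive_add da (derive_opp db); apply; rewrite subrr.
  have key y z : b < y -> y <= z -> I a y + - I b y = I a z + - I b z.
    move=> bY yz; apply/eqP; rewrite eq_le; apply/andP; split.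
      apply: (derive_le (f := fun t => I a t + - I b t) (f' := fun=> 0)) => //.
      by move=> u /andP[yu _]; apply: dab; lra.
    rewrite -lerN2.
    apply: (derive_le (f := fun t => - (I a t + - I b t)) (f' := fun=> - 0)).
    - by [].
    - by move=> u /andP[yu _]; apply/derive_opp/dab; lra.
    - by move=> *; rewrite oppr0.
  have [x0|x0] := leP x 0; first by have := key _ _ bx x0; lra.
  by have := key _ _ b0 (ltW x0); lra.
exists (fun x => I (- `|x| - 1) x - I (- `|x| - 1) 0); split; first by rewrite subrr.
move=> x.
have n0 := normr_ge0 x; have /andP[n1 _] : - `|x| <= x <= `|x| by rewrite -ler_norml.
(* A base point to the left of all the moving ones for [t] near [x]: the lower limit then no longer
   depends on [t], and the fundamental theorem applies. *)
pose A := - `|x| - 3.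
have [+ +] : is_derive x 1 (fun t => I A t - I A 0) (f x).
  have /dI dA : A < x by rewrite /A; lra.
  by have /is_derive_eq := derive_add dA (derive_cst (- I A 0) x); apply; rewrite addr0.
move=> dA eA.
have near_eq : \forall t \near x, I A t - I A 0 = I (- `|t| - 1) t - I (- `|t| - 1) 0.
  near=> t; apply: base.
  - suff : `|t| < `|x| + 1 by rewrite /A; lra.
    by have := ler_normD x (t - x); rewrite addrC subrK => /le_lt_trans; apply;
       rewrite ltrD2l distrC; near: t; apply: cvgr_dist_lt => //.
  - by have := ler_norml t `|t|; rewrite lexx => /esym/andP[]; lra.
  - by have := normr_ge0 t; lra.
have [d e] := near_eq_is_derive near_eq (DeriveDef dA eA).
by constructor.
Unshelve. all: by end_near. Qed.

End Primitives.

Section Shifts.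
Context {R : realType}.
Implicit Types (f F : R -> R) (a c x : R).

Lemma derive_shift f a c x : is_derive (x + c) 1 f a ->
  is_derive x 1 (fun t => f (t + c)) a.
Proof.
move=> df; have ds := derive_add (derive_id x) (derive_cst c x).
by have /is_derive_eq := derive_comp (g := fun t => t + c) df ds; apply; ring.
Qed.

Lemma derive_reflect f a c x : is_derive (c - x) 1 f a ->
  is_derive x 1 (fun t => f (c - t)) (- a).
Proof.
move=> df; have ds := derive_add (derive_cst c x) (derive_opp (derive_id x)).
by have /is_derive_eq := derive_comp (g := fun t => c - t) df ds; apply; ring.
Qed.

Lemma odd_primitive f F : (forall x, f (- x) = f x) ->
  (forall x, is_derive x 1 F (f x)) -> F 0 = 0 -> forall x, F (- x) = - F x.
Proof.
move=> ef dF F0 x.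
have dF' (y : R) : is_derive y 1 (fun t => - F (0 - t)) (f y).
  have /derive_reflect/derive_opp := dF (0 - y).
  by move/is_derive_eq; apply; rewrite opprK sub0r ef.
by have := derive_eq dF dF' 0 x; rewrite !sub0r oppr0 F0; lra.
Qed.

End Shifts.

Section HalfLineIntegrals.
Context {R : realType}.
Implicit Types (f F : R -> R) (B x : R).

(** Monotone convergence: [l] is the supremum of [F] on the half-line. That it is the least upper
    bound, the last clause, lets integral bounds be read off bounds on [F]. *)
Lemma nonneg_integral_halfline f F B : continuous f ->
  (forall x, 0 <= x -> 0 <= f x) -> (forall x, is_derive x 1 F (f x)) ->
  (forall x, 0 <= x -> F x <= B) ->
  exists l, [/\ l <= B, forall x, 0 <= x -> F x <= l,
    (\int[@lebesgue_measure R]_(x in `[0%R, +oo[) (f x)%:E = (l - F 0)%:E)%E &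
    forall B', (forall x, 0 <= x -> F x <= B') -> l <= B'].
Proof.
move=> cf f0 dF FB.
(* Freezing [F] to the left of 0 makes it monotone on the whole line, as the convergence of monotone
   functions asks. *)
pose g x := F (Num.max 0 x).
have ndF x y : 0 <= x -> x <= y -> F x <= F y.
  move=> x0 xy; apply: (derive_le (f' := f)) => // z /andP[xz _].
  by apply: f0; lra.
have ndg : nondecreasing_fun g.
  move=> x y xy; apply: ndF; first by rewrite le_max lexx.
  by rewrite ge_max !le_max lexx xy !orbT.
have ubg : has_ubound (range g).
  by exists B => _ [x _ <-]; apply: FB; rewrite le_max lexx.
have cvg_g := nondecreasing_cvgr ndg ubg.
have Fg x : 0 <= x -> F x = g x by move=> x0; rewrite /g max_r.
have supB B' : (forall x, 0 <= x -> F x <= B') -> sup (range g) <= B'.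
  move=> FB'; apply: ge_sup; first by exists (g 0), 0.
  by move=> _ [x _ <-]; apply: FB'; rewrite le_max lexx.
exists (sup (range g)); split => //.
- exact: supB.
- by move=> x x0; rewrite Fg//; apply: ub_le_sup => //; exists x.
- rewrite EFinB; apply: ge0_continuous_FTC2y => //.
  + exact: continuous_subspaceT.
  + apply: cvg_trans cvg_g; apply: near_eq_cvg.
    by near=> x; rewrite Fg//; near: x; apply: nbhs_pinfty_ge; rewrite num_real.
  + exact/cvg_at_right_filter/(is_derive_continuous (dF 0)).
  + by move=> x _; apply: is_derive_derive1.
Unshelve. all: by end_near. Qed.

Lemma even_integral_le f F B : continuous f -> (forall x, 0 <= f x) ->
  even_fun f -> F 0 = 0 -> (forall x, is_derive x 1 F (f x)) ->
  (forall x, 0 <= x -> 2 * F x <= B) ->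
  (\int[@lebesgue_measure R]_x (f x)%:E <= B%:E)%E.
Proof.
move=> cf f0 ef F0 dF FB.
have [|l [lB _ E _]] := @nonneg_integral_halfline f F (B / 2) cf (fun x _ => f0 x) dF.
  by move=> x /FB; lra.
rewrite ge0_symfun_integralT//; last by move=> x /=; rewrite ef.
by rewrite -set_itvcy E -EFinM lee_fin F0; lra.
Qed.

Lemma even_integral_ge f F x : continuous f -> (forall x, 0 <= f x) ->
  even_fun f -> F 0 = 0 -> (forall x, is_derive x 1 F (f x)) -> 0 <= x ->
  ((2 * F x)%:E <= \int[@lebesgue_measure R]_x (f x)%:E)%E.
Proof.
move=> cf f0 ef F0 dF; rewrite le_eqVlt => /predU1P[<-|x0].
  by rewrite F0 mulr0 integral_ge0// => y _; rewrite lee_fin.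
rewrite ge0_symfun_integralT//; last by move=> y /=; rewrite ef.
rewrite -set_itvcy EFinM; apply: lee_wpmul2l; first by rewrite lee_fin.
have <- : (\int[@lebesgue_measure R]_(y in `[0%R, x]) (f y)%:E = (F x)%:E)%E.
  rewrite (@continuous_FTC2 R f F 0 x) ?F0 ?sube0//.
  - exact: continuous_subspaceT.
  - split.
    + by move=> y _; case: (dF y).
    + exact/cvg_at_right_filter/(is_derive_continuous (dF 0)).
    + exact/cvg_at_left_filter/(is_derive_continuous (dF x)).
  - by move=> y _; apply: is_derive_derive1.
apply: ge0_subset_integral => //.
- by apply: measurableT_comp => //; apply: measurable_funTS; apply: continuous_measurable_fun.
- by move=> y _; rewrite lee_fin.
- by move=> y /=; rewrite !in_itv/= => /andP[->].
Qed.

End HalfLineIntegrals.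

(** * The nonlinearity and its growth away from the singularity at 1 *)

Section Nonlinearity.
Context {R : realType}.
Implicit Types m r : R.

Definition dPhi m r : R := ((1 - r) `^ (- (m + 1)) - 1) / (m + 1).

Lemma derive_Phi m r : 0 < m -> r < 1 -> is_derive r 1 (Phi m) (dPhi m r).
Proof.
move=> m0 r1; have r0 : 0 < 1 - r by lra.
have dr : is_derive r 1 (fun t : R => 1 - t) (- 1).
  by have /is_derive_eq := derive_add (derive_cst 1 r) (derive_opp (derive_id r)); apply; lra.
have dp := derive_powR (- m) dr r0.
have dl := derive_mul (derive_cst m r) (derive_id r).
have d1 := derive_add dp (derive_opp dl).
have d2 := derive_add d1 (derive_cst (- 1) r).
have /is_derive_eq := derive_mul (derive_cst (m * (m + 1))^-1 r) d2; apply.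
rewrite /dPhi (_ : - m - 1 = - (m + 1)); last by ring.
by field; lra.
Qed.

Lemma derive_dPhi m r : 0 < m -> r < 1 ->
  is_derive r 1 (dPhi m) ((1 - r) `^ (- (m + 2))).
Proof.
move=> m0 r1; have r0 : 0 < 1 - r by lra.
have dr : is_derive r 1 (fun t : R => 1 - t) (- 1).
  by have /is_derive_eq := derive_add (derive_cst 1 r) (derive_opp (derive_id r)); apply; lra.
have dp := derive_add (derive_powR (- (m + 1)) dr r0) (derive_cst (- 1) r).
have /is_derive_eq := derive_mul dp (derive_cst (m + 1)^-1 r); apply.
rewrite (_ : - (m + 1) - 1 = - (m + 2)); last by ring.
by field; lra.
Qed.

Lemma powRN_le p (x y : R) : 0 <= p -> 0 < x -> x <= y -> y `^ (- p) <= x `^ (- p).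
Proof.
move=> p0 x0 xy; rewrite !powRN lef_pV2 ?posrE ?powR_gt0//; last by lra.
by apply: ge0_ler_powR => //; rewrite nnegrE; lra.
Qed.

Lemma dPhi0 m : dPhi m 0 = 0.
Proof. by rewrite /dPhi subr0 powR1 subrr mul0r. Qed.

Lemma dPhi_le m r s : 0 < m -> r <= s -> s < 1 -> dPhi m r <= dPhi m s.
Proof.
move=> m0 rs s1; rewrite /dPhi ler_pM2r ?invr_gt0; last by lra.
by rewrite lerD2r powRN_le//; lra.
Qed.

Lemma dPhi_lt m r s : 0 < m -> r < s -> s < 1 -> dPhi m r < dPhi m s.
Proof.
move=> m0 rs s1.
apply: (derive_lt rs (f' := fun t => (1 - t) `^ (- (m + 2)))).
  by move=> t /andP[_ ts]; apply: derive_dPhi => //; lra.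
by move=> t /andP[_ ts]; apply: powR_gt0; lra.
Qed.

Lemma dPhi_ge0 m r : 0 < m -> 0 <= r -> r < 1 -> 0 <= dPhi m r.
Proof. by move=> m0 r0 r1; rewrite -(dPhi0 m) dPhi_le. Qed.

(** [dPhi m] vanishes at 0 and its derivative is at most [q ^ -(m + 2)] up to [1 - q]. Applied with
    [q = 1/4] where [Rw <= 3/4]. *)
Lemma dPhi_le_linear m r q : 0 < m -> 0 <= r <= 1 - q -> 0 < q ->
  dPhi m r <= q `^ (- (m + 2)) * r.
Proof.
move=> m0 /andP[r0 rq] q0.
have := @derive_cmp R (dPhi m) (fun t => q `^ (- (m + 2)) * t)
  (fun t => (1 - t) `^ (- (m + 2))) (fun=> q `^ (- (m + 2))) 0 r r0.
rewrite dPhi0 mulr0 !subr0; apply.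
- by move=> t /andP[t0 tr]; apply: derive_dPhi => //; lra.
- move=> t _; have /is_derive_eq := derive_mul (derive_cst (q `^ (- (m + 2))) t) (derive_id t).
  by apply; ring.
- by move=> t /andP[t0 tr]; apply: powRN_le; lra.
Qed.

Lemma Phi_ge0_le m r q : 0 < m -> 0 <= r <= 1 - q -> 0 < q ->
  0 <= Phi m r <= q `^ (- (m + 2)) * (r ^+ 2 / 2).
Proof.
move=> m0 /andP[r0 rq] q0.
have Phi0 : Phi m 0 = 0 by rewrite /Phi subr0 powR1 mulr0 subr0 subrr mulr0.
have dP t : 0 <= t <= r -> is_derive t 1 (Phi m) (dPhi m t).
  by move=> /andP[t0 tr]; apply: derive_Phi => //; lra.
apply/andP; split.
  rewrite -Phi0; apply: (derive_le r0 dP) => t /andP[t0 tr].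
  by apply: dPhi_ge0; lra.
have := @derive_cmp R (Phi m) (fun t => q `^ (- (m + 2)) * (t ^+ 2 / 2))
  (dPhi m) (fun t => q `^ (- (m + 2)) * t) 0 r r0 dP.
rewrite Phi0 expr0n/= mul0r mulr0 !subr0; apply.
- move=> t _.
  have d2 := derive_mul (derive_sqr (derive_id t)) (derive_cst 2^-1 t).
  have /is_derive_eq := derive_mul (derive_cst (q `^ (- (m + 2))) t) d2.
  by apply; field.
- by move=> t /andP[t0 tr]; apply: dPhi_le_linear => //; lra.
Qed.

End Nonlinearity.

(** * Solitary waves as monotone even profiles with primitives *)

Section WavePrimitives.
Context {R : realType}.
Implicit Types (m sigma N : R) (V Rw F G W : R -> R).

Record nonincreasing_profile V : Prop := NonincreasingProfile {
  np_ge0 : forall x, 0 <= V x ;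
  np_even : forall x, V (- x) = V x ;
  np_le : forall x y, 0 <= x -> x <= y -> V y <= V x }.

(* [F], [G], [W] are the odd primitives of [V], [dPhi m \o Rw], [V ^ 2], and
   [N] is the squared norm of [V]. *)
Record wave_primitives m V Rw sigma N F G W : Prop := WavePrimitives {
  wp_m : 1 < m ;
  wp_sigma : 0 < sigma ;
  wp_V : nonincreasing_profile V ;
  wp_R : nonincreasing_profile Rw ;
  wp_lt1 : forall x, Rw x < 1 ;
  wp_F : forall x : R, is_derive x 1 F (V x) ;
  wp_G : forall x : R, is_derive x 1 G (dPhi m (Rw x)) ;
  wp_W : forall x : R, is_derive x 1 W (V x ^+ 2) ;
  wp_F0 : F 0 = 0 ;
  wp_G0 : G 0 = 0 ;
  wp_W0 : W 0 = 0 ;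
  wp_RE : forall x, Rw x = F (x + 2^-1) - F (x - 2^-1) ;
  wp_VE : forall x, sigma * V x = G (x + 2^-1) - G (x - 2^-1) ;
  wp_N1 : N <= 1 ;
  wp_leN : forall x, 0 <= x -> 2 * W x <= N ;
  wp_Nle : forall B, (forall x, 0 <= x -> 2 * W x <= B) -> N <= B }.

(** [unimodal] compares only points strictly on one side of 0; continuity from the right adds the
    point 0 itself. *)
Lemma unimodal_nonincreasing V : continuous V -> nonneg_fun V -> even_fun V ->
  unimodal V -> nonincreasing_profile V.
Proof.
move=> cV V0 eV [_ uV]; split => // x y; rewrite le_eqVlt => /predU1P[<-|]; last exact: uV.
rewrite le_eqVlt => /predU1P[->//|y0].
have V0r : V t @[t --> 0^'+] --> V 0 by apply: cvg_at_right_filter; exact: cV.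
apply: (cvgr_to_ge V0r); near=> t; apply: uV; first by near: t; apply: nbhs_right_gt.
by near: t; apply: nbhs_right_le.
Unshelve. all: by end_near. Qed.

Lemma BC1_continuous V : isBC1 V -> continuous V.
Proof. by case=> dV _ _ _ x; apply/differentiable_continuous/derivable1_diffP. Qed.

(** The squared norm enters through [wp_leN] and [wp_Nle], which make [N] the supremum of [2 * W] on
    the half-line; from here on [V] is never integrated again, only its primitives are compared. *)
Lemma wave_primitives_exist m V Rw sigma d : 1 < m -> 0 < d < 1 ->
  solitary_wave m V Rw sigma ->
  [/\ isBC1 V, nonneg_fun V, even_fun V & unimodal V] ->
  [/\ isBC1 Rw, nonneg_fun Rw, even_fun Rw & unimodal Rw] ->
  ('N[@lebesgue_measure R]_2%:E [EFin \o V] = (1 - d)%:E)%E ->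
  exists F G W, wave_primitives m V Rw sigma ((1 - d) ^+ 2) F G W.
Proof.
move=> m1 /andP[d0 d1] [s0 _ Rlt1 RE VE] [/BC1_continuous cV V0 eV uV] [/BC1_continuous cR R0 eR uR] nV.
have cPhi : continuous (fun x => dPhi m (Rw x)).
  move=> x; apply: continuous_comp; first exact: cR.
  by apply/is_derive_continuous/derive_dPhi => //; lra.
have cV2 : continuous (fun x => V x ^+ 2).
  move=> x; apply: (@continuous_comp _ _ _ V (fun t => t ^+ 2)); first exact: cV.
  exact: exprn_continuous.
have [F [F0 dF]] := continuous_primitive cV.
have [G [G0 dG]] := continuous_primitive cPhi.
have [W [W0 dW]] := continuous_primitive cV2.
have V2ge0 x : 0 <= V x ^+ 2 by apply: sqr_ge0.
have V2e : even_fun (fun x => V x ^+ 2) by move=> x; rewrite eV.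
have intV2 : (\int[@lebesgue_measure R]_x (V x ^+ 2)%:E = ((1 - d) ^+ 2)%:E)%E.
  have := @poweR_Lnorm _ _ R (@lebesgue_measure R) (EFin \o V) 2 ltac:(lra).
  rewrite nV poweR_EFin powR_mulrn; last by lra.
  move=> ->; apply: eq_integral => x _ /=.
  by rewrite powR_mulrn// real_normK// num_real.
exists F, G, W; split => //.
- exact: unimodal_nonincreasing.
- exact: unimodal_nonincreasing.
- by move=> x; rewrite RE; apply: continuous_integral_primitive => //; lra.
- move=> x; rewrite VE /avg.
  rewrite (_ : (fun y => (Phi m)^`() (Rw y)) = fun y => dPhi m (Rw y)); last first.
    by apply/funext => y; apply: is_derive_derive1; apply: derive_Phi => //; lra.
  by apply: continuous_integral_primitive => //; lra.
- by nra.
- move=> x x0; have := even_integral_ge cV2 V2ge0 V2e W0 dW x0.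
  by rewrite intV2 lee_fin.
- move=> B WB; have := even_integral_le cV2 V2ge0 V2e W0 dW WB.
  by rewrite intV2 lee_fin.
Qed.

End WavePrimitives.

(** * A priori bounds: energy, and concentration of [V] on [-1/2, 1/2] *)

Section WaveEstimates.
Context {R : realType} (m : R) (V Rw : R -> R) (sigma N : R) (F G W : R -> R).
Context (hw : wave_primitives m V Rw sigma N F G W).

Let eps := 1 - Rw 0.

Lemma wave_m_gt0 : 0 < m.
Proof. by have := wp_m hw; lra. Qed.

Lemma Rw_ge0 x : 0 <= Rw x. Proof. exact: np_ge0 (wp_R hw) x. Qed.

Lemma V_ge0 x : 0 <= V x. Proof. exact: np_ge0 (wp_V hw) x. Qed.

Lemma eps_gt0 : 0 < eps.
Proof. by rewrite /eps; have := wp_lt1 hw 0; lra. Qed.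

Lemma dPhi_Rw_ge0 x : 0 <= dPhi m (Rw x).
Proof. by apply: dPhi_ge0; [exact: wave_m_gt0|exact: Rw_ge0|exact: (wp_lt1 hw)]. Qed.

Lemma F_odd x : F (- x) = - F x.
Proof. exact: odd_primitive (np_even (wp_V hw)) (wp_F hw) (wp_F0 hw) x. Qed.

Lemma G_odd x : G (- x) = - G x.
Proof.
apply: odd_primitive (wp_G hw) (wp_G0 hw) x => x.
by rewrite (np_even (wp_R hw)).
Qed.

Lemma Rw_le0 x : Rw x <= Rw 0.
Proof.
have [x0|x0] := leP 0 x; first exact: (np_le (wp_R hw)).
by rewrite -(np_even (wp_R hw)); apply: (np_le (wp_R hw)); lra.
Qed.

Lemma F_half : F 2^-1 = (1 - eps) / 2.
Proof.
have := wp_RE hw 0; rewrite add0r sub0r F_odd /eps; lra.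
Qed.

Lemma derive_Rw (x : R) : is_derive x 1 Rw (V (x + 2^-1) - V (x - 2^-1)).
Proof.
have d1 := derive_shift (wp_F hw (x + 2^-1)).
have d2 := derive_shift (wp_F hw (x - 2^-1)).
by apply: eq_is_derive (derive_add d1 (derive_opp d2)) _ => t; rewrite (wp_RE hw).
Qed.

Lemma derive_V (x : R) :
  is_derive x 1 V ((dPhi m (Rw (x + 2^-1)) - dPhi m (Rw (x - 2^-1))) / sigma).
Proof.
have s0 := wp_sigma hw.
have d1 := derive_shift (wp_G hw (x + 2^-1)).
have d2 := derive_shift (wp_G hw (x - 2^-1)).
have d := derive_mul (derive_add d1 (derive_opp d2)) (derive_cst sigma^-1 x).
apply: eq_is_derive (is_derive_eq d _) _; first by ring.
by move=> t; rewrite -(wp_VE hw) mulrAC mulfV ?mul1r//; lra.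
Qed.

Lemma F_increment a b : 0 <= a -> a <= b ->
  (b - a) * V b <= F b - F a <= (b - a) * V a.
Proof.
move=> a0 ab; have dF x (_ : a <= x <= b) := wp_F hw x.
have dc c (x : R) : a <= x <= b -> is_derive x 1 (fun t => c * t) c.
  move=> _; have /is_derive_eq := derive_mul (derive_cst c x) (derive_id x).
  by apply; ring.
apply/andP; split.
  have := derive_cmp ab (dc (V b)) dF; rewrite -mulrBr mulrC; apply.
  by move=> x /andP[ax xb]; apply: (np_le (wp_V hw)); lra.
have := derive_cmp ab dF (dc (V a)); rewrite -mulrBr mulrC; apply.
by move=> x /andP[ax xb]; apply: (np_le (wp_V hw)); lra.
Qed.

Lemma Rw_le_V x : 2^-1 <= x -> Rw x <= V (x - 2^-1).
Proof.
move=> x2; rewrite (wp_RE hw).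
have /andP[_] := @F_increment (x - 2^-1) (x + 2^-1) ltac:(lra) ltac:(lra).
by move/le_trans; apply; rewrite (_ : _ - _ = 1) ?mul1r//; field.
Qed.

Lemma G_le a b : a <= b -> G a <= G b.
Proof.
move=> ab; apply: (derive_le ab (fun x _ => wp_G hw x)) => x _.
exact: dPhi_Rw_ge0.
Qed.

Lemma W_le a b : a <= b -> W a <= W b.
Proof.
by move=> ab; apply: (derive_le ab (fun x _ => wp_W hw x)) => x _; rewrite sqr_ge0.
Qed.

(** With the blow-up of the potential energy this forces [eps -> 0]. Since [Rw <= 1 - eps], [Phi] is
    at most [eps ^ -(m + 2) * Rw ^ 2 / 2], and [Rw ^ 2] has integral at most 1 on the half-line: up
    to 1/2 because [Rw < 1], beyond because [Rw x <= V (x - 1/2)] and [V ^ 2] has integral at most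
    1/2 there. *)
Lemma potential_energy_le : (potential_energy m Rw <= (eps `^ (- (m + 2)))%:E)%E.
Proof.
have m0 := wave_m_gt0; have e0 := eps_gt0.
set K := eps `^ _; have K0 : 0 <= K by apply: powR_ge0.
have Phi_bnd x : 0 <= Phi m (Rw x) <= K * (Rw x ^+ 2 / 2).
  by apply: Phi_ge0_le => //; rewrite Rw_ge0/= /eps; have := Rw_le0 x; lra.
have cP : continuous (fun x => Phi m (Rw x)).
  move=> x; apply: continuous_comp; first exact: is_derive_continuous (derive_Rw x).
  by apply/is_derive_continuous/derive_Phi => //; apply: (wp_lt1 hw).
have [P [P0 dP]] := continuous_primitive cP.
apply: (even_integral_le cP _ _ P0 dP).
- by move=> x; case/andP: (Phi_bnd x).
- by move=> x; rewrite (np_even (wp_R hw)).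
have ndP a b : a <= b -> P a <= P b.
  move=> ab; apply: (derive_le ab (fun x _ => dP x)) => x _.
  by case/andP: (Phi_bnd x).
have Phalf : P 2^-1 <= K / 4.
  have := @derive_cmp R P (fun t => K / 2 * t) (fun x => Phi m (Rw x)) (fun=> K / 2) 0 2^-1
    ltac:(lra) (fun x _ => dP x).
  rewrite P0 mulr0 !subr0 => H; suff : P 2^-1 <= K / 2 / 2 by lra.
  apply: H.
  - move=> x _; have /is_derive_eq := derive_mul (derive_cst (K / 2) x) (derive_id x).
    by apply; ring.
  - move=> x _; have /andP[_ /le_trans] := Phi_bnd x; apply.
    have := Rw_ge0 x; have := wp_lt1 hw x => r1 r0.
    have : Rw x ^+ 2 <= 1 by rewrite expr_le1//; lra.
    by move=> r2; rewrite mulrA mulrAC; nra.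
have Wtail x : 2^-1 <= x -> P x - P 2^-1 <= K / 2 * W (x - 2^-1).
  move=> x2.
  have := @derive_cmp R P (fun t => K / 2 * W (t - 2^-1)) (fun x => Phi m (Rw x))
    (fun x => K / 2 * V (x - 2^-1) ^+ 2) 2^-1 x x2 (fun x _ => dP x).
  rewrite subrr (wp_W0 hw) mulr0 subr0; apply.
  - move=> t _; have /is_derive_eq := derive_mul (derive_cst (K / 2) t)
      (derive_shift (wp_W hw (t - 2^-1))).
    by apply; ring.
  - move=> t /andP[t2 _]; have /andP[_ /le_trans] := Phi_bnd t; apply.
    have RV := Rw_le_V (ltW t2); have r0 := Rw_ge0 t.
    have : Rw t ^+ 2 <= V (t - 2^-1) ^+ 2 by rewrite ler_pXn2r// nnegrE; lra.
    by move=> r2; rewrite mulrA mulrAC; nra.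
move=> x x0; have [x2|/ltW x2] := leP x 2^-1.
  by have := ndP _ _ x2; lra.
have := Wtail _ x2; have := wp_leN hw (x := x - 2^-1) ltac:(lra).
by have := wp_N1 hw; nra.
Qed.

(** As [G] is nondecreasing, [sigma * V 0 = 2 * G (1/2) <= 2 * G 1 = 2 * sigma * V (1/2)], and
    [sigma] cancels. Moreover [V (1/2) <= 1], since [V] decreases and its integral over [0, 1/2] is
    [(1 - eps) / 2]. *)
Lemma V0_le2 : V 0 <= 2.
Proof.
have s0 := wp_sigma hw.
have VE1 := wp_VE hw 2^-1; have VE0 := wp_VE hw 0.
rewrite subrr (wp_G0 hw) in VE1; rewrite add0r sub0r G_odd in VE0.
have g : G 2^-1 <= G (2^-1 + 2^-1) by apply: G_le; lra.
have : sigma * V 0 <= sigma * (2 * V 2^-1) by lra.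
rewrite ler_pM2l// => V02.
have /andP[] := @F_increment 0 2^-1 ltac:(lra) ltac:(lra).
rewrite (wp_F0 hw) F_half; have := eps_gt0; lra.
Qed.

(* Cauchy-Schwarz on [0, 1/2]. *)
Lemma W_half_ge : 2 * F 2^-1 ^+ 2 <= W 2^-1.
Proof.
set c := F 2^-1.
have d (x : R) : is_derive x 1 (fun t => W t + (- (4 * c) * F t + 4 * c ^+ 2 * t))
    ((V x - 2 * c) ^+ 2).
  have d1 := derive_mul (derive_cst (- (4 * c)) x) (wp_F hw x).
  have d2 := derive_mul (derive_cst (4 * c ^+ 2) x) (derive_id x).
  by have /is_derive_eq := derive_add (wp_W hw x) (derive_add d1 d2); apply; ring.
have := derive_le (f := fun t => W t + (- (4 * c) * F t + 4 * c ^+ 2 * t))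
  (a := 0) (b := 2^-1) ltac:(lra) (fun x _ => d x) (fun x _ => sqr_ge0 _).
by rewrite (wp_W0 hw) (wp_F0 hw) -/c; nra.
Qed.

(** Cauchy-Schwarz places mass at least [(1 - eps) ^ 2] of [N <= 1] on [-1/2, 1/2], so at most
    [2 * eps] is left outside, half of it on each side. *)
Lemma W_increment_le : W 1 - W 2^-1 <= eps.
Proof.
have := W_half_ge; have := wp_leN hw (x := 1) ltac:(lra); have := wp_N1 hw.
by rewrite F_half; nra.
Qed.

(** Passes from the mass of [V ^ 2] to that of [V] by [v <= 2 * v ^ 2 + 1/8], which is
    [2 * (v - 1/4) ^ 2 >= 0]; the 1/16 is 1/8 times the length of [1/2, 1]. *)
Lemma F_increment_le : F 1 - F 2^-1 <= 2 * eps + 16^-1.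
Proof.
have := @derive_cmp R F (fun t => 2 * W t + 8^-1 * t) V (fun x => 2 * V x ^+ 2 + 8^-1)
  2^-1 1 ltac:(lra) (fun x _ => wp_F hw x).
have := W_increment_le => We; move=> H.
suff : F 1 - F 2^-1 <= 2 * W 1 + 8^-1 * 1 - (2 * W 2^-1 + 8^-1 / 2) by lra.
apply: H.
- move=> x _; have d1 := derive_mul (derive_cst 2 x) (wp_W hw x).
  have d2 := derive_mul (derive_cst 8^-1 x) (derive_id x).
  by have /is_derive_eq := derive_add d1 d2; apply; ring.
- by move=> x _; have := sqr_ge0 (V x - 4^-1); nra.
Qed.

(** [Rw (1/2) = F 1], and the bound [(1 - eps) / 2 + 2 * eps + 1/16] reaches 3/4 exactly at
    [eps = 1/8]. *)
Lemma Rw_half_le : eps <= 8^-1 -> Rw 2^-1 <= 3 / 4.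
Proof.
move=> e8; rewrite (wp_RE hw) subrr (wp_F0 hw) (_ : 2^-1 + 2^-1 = 1 :> R); last by field.
by have := F_increment_le; rewrite F_half; lra.
Qed.

(** Crude but free of [sigma]: it serves before [1 / sigma] is known to be small. *)
Lemma V1_le_eps : V 1 <= 4 * eps + 8^-1.
Proof.
have /andP[] := @F_increment 2^-1 1 ltac:(lra) ltac:(lra).
by have := F_increment_le; lra.
Qed.

Lemma V0_ge : 1 - eps <= V 0.
Proof.
have /andP[_] := @F_increment 0 2^-1 ltac:(lra) ltac:(lra).
by rewrite F_half (wp_F0 hw); lra.
Qed.

End WaveEstimates.

(** This is [4 ^ (m + 2)], the value of [Phi''] at 3/4, hence a bound for [Phi''] on the values of
    [Rw] beyond 1/2. *)
Definition far_bound {R : realType} (m : R) : R := 4^-1 `^ (- (m + 2)).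

Lemma far_bound_gt0 {R : realType} (m : R) : 0 < far_bound m.
Proof. by apply: powR_gt0; lra. Qed.

(** * Decay of [V] beyond 1 and its reflection about 1/2 *)

Section WaveDecay.
Context {R : realType} (m : R) (V Rw : R -> R) (sigma N : R) (F G W : R -> R).
Context (hw : wave_primitives m V Rw sigma N F G W).

Let eps := 1 - Rw 0.
Let L := far_bound m.
Let e := L / sigma.

Context (e8 : eps <= 8^-1).

Lemma far_ratio_gt0 : 0 < e.
Proof. exact: divr_gt0 (far_bound_gt0 m) (wp_sigma hw). Qed.

Lemma Rw_far x : 2^-1 <= x -> Rw x <= 3 / 4.
Proof.
move=> x2; apply: le_trans (Rw_half_le hw e8).
by apply: (np_le (wp_R hw)) => //; lra.
Qed.

Lemma dPhi_far x : 2^-1 <= x -> dPhi m (Rw x) <= L * Rw x.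
Proof.
move=> x2; apply: dPhi_le_linear; [exact: wave_m_gt0 hw| |by lra].
by rewrite (Rw_ge0 hw)/=; have := Rw_far x2; lra.
Qed.

Lemma dPhi_far_le x : 2^-1 <= x -> dPhi m (Rw x) <= L.
Proof.
move=> x2; apply: le_trans (dPhi_far x2) _; have := wp_lt1 hw x.
by have := far_bound_gt0 m; rewrite -/L; nra.
Qed.

Lemma sigma_V_far x : 1 <= x -> sigma * V x <= L * Rw (x - 2^-1).
Proof.
move=> x1; rewrite (wp_VE hw); set q := L * _.
have := @derive_cmp R G (fun t => q * t) (fun x => dPhi m (Rw x)) (fun=> q)
  (x - 2^-1) (x + 2^-1) ltac:(lra) (fun x _ => wp_G hw x).
rewrite -mulrBr (_ : x + 2^-1 - (x - 2^-1) = 1); last by field.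
rewrite mulr1; apply.
- move=> t _; have /is_derive_eq := derive_mul (derive_cst q t) (derive_id t).
  by apply; ring.
- move=> t /andP[xt _]; apply: le_trans (dPhi_far _) _; first by lra.
  rewrite ler_pM2l ?far_bound_gt0//.
  by apply: (np_le (wp_R hw)); lra.
Qed.

Lemma V1_le : V 1 <= e.
Proof.
have s0 := wp_sigma hw; rewrite /e ler_pdivlMr// mulrC.
apply: le_trans (sigma_V_far (lexx 1)) _; have := wp_lt1 hw (1 - 2^-1).
by have := far_bound_gt0 m; rewrite -/L; nra.
Qed.

(** The wave equation as a contraction: [sigma * V x] is at most [L] times [Rw (x - 1/2)], an
    average of [V] over [x - 1, x] and so at most [V (x - 1)]. *)
Lemma V_tail x : 1 <= x -> V x <= e * V (x - 1).
Proof.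
move=> x1; have s0 := wp_sigma hw; rewrite /e mulrAC ler_pdivlMr// mulrC.
apply: le_trans (sigma_V_far x1) _; rewrite ler_pM2l ?far_bound_gt0//.
have := @Rw_le_V _ _ _ _ _ _ _ _ _ hw (x - 2^-1) ltac:(lra).
by rewrite (_ : x - 2^-1 - 2^-1 = x - 1) //; field.
Qed.

(** Squaring [V_tail] bounds the mass beyond 1 by [e ^ 2] times the mass on the half-line, which is
    at most 1/2. *)
Lemma norm_le_W1 : N <= 2 * W 1 + e ^+ 2.
Proof.
have e0 := far_ratio_gt0.
apply: (wp_Nle hw) => x x0; have [x1|/ltW x1] := leP x 1.
  by have := W_le hw x1; nra.
have := @derive_cmp R W (fun t => e ^+ 2 * W (t - 1)) (fun x => V x ^+ 2)
  (fun x => e ^+ 2 * V (x - 1) ^+ 2) 1 x x1 (fun x _ => wp_W hw x).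
rewrite subrr (wp_W0 hw) mulr0 subr0 => H.
suff : W x - W 1 <= e ^+ 2 * W (x - 1).
  have := wp_leN hw (x := x - 1) ltac:(lra); have := wp_N1 hw.
  by have := sqr_ge0 e; nra.
apply: H.
- move=> t _; have /is_derive_eq := derive_mul (derive_cst (e ^+ 2) t)
    (derive_shift (wp_W hw (t - 1))).
  by apply; ring.
- move=> t /andP[/ltW t1 _]; rewrite -exprMn ler_pXn2r ?nnegrE ?(V_ge0 hw)//.
    exact: V_tail.
  by rewrite mulr_ge0 ?(V_ge0 hw)// ltW.
Qed.

(** In the derivative of the sum the two large terms, [Phi'] at [Rw t] and at [Rw (- t)], cancel
    because [Rw] is even. What remains is evaluated at [1 + t] and [1 - t], where [Rw <= 3/4], and
    is nonpositive by monotonicity. At [t = 1/2] the sum is [V 0 + V 1]. *)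
Lemma V_reflection y : 0 <= y <= 2^-1 ->
  V 0 <= V (2^-1 + y) + V (2^-1 - y) <= V 0 + 2 * e.
Proof.
move=> /andP[y0 y2]; have s0 := wp_sigma hw; have m0 := wave_m_gt0 hw.
pose c t := V (2^-1 + t) + V (2^-1 - t).
have dc (t : R) : is_derive t 1 c
    ((dPhi m (Rw (1 + t)) - dPhi m (Rw (1 - t))) / sigma).
  have d1 := derive_shift (derive_V hw (t + 2^-1)).
  have d2 := derive_reflect (derive_V hw (2^-1 - t)).
  apply: eq_is_derive (is_derive_eq (derive_add d1 d2) _) _; last first.
    by move=> u; rewrite /c addrC (addrC u) addrC.
  rewrite (_ : t + 2^-1 + 2^-1 = 1 + t); last by field.
  rewrite (_ : t + 2^-1 - 2^-1 = t); last by field.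
  rewrite (_ : 2^-1 - t + 2^-1 = 1 - t); last by field.
  rewrite (_ : 2^-1 - t - 2^-1 = - t); last by field.
  by rewrite (np_even (wp_R hw)); field; lra.
have dc_bnd t : y < t < 2^-1 ->
    - e <= (dPhi m (Rw (1 + t)) - dPhi m (Rw (1 - t))) / sigma <= 0.
  move=> /andP[yt t2]; rewrite /e -mulNr ler_pM2r ?invr_gt0//.
  have far1 := dPhi_far_le (x := 1 - t) ltac:(lra).
  have ge1 := dPhi_Rw_ge0 hw (1 + t).
  have mono : dPhi m (Rw (1 + t)) <= dPhi m (Rw (1 - t)).
    by apply: dPhi_le => //; [apply: (np_le (wp_R hw)); lra|exact: (wp_lt1 hw)].
  by rewrite pmulr_lle0 ?invr_gt0//; lra.
have cE : c 2^-1 = V 0 + V 1.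
  by rewrite /c subrr addrC (_ : 2^-1 + 2^-1 = 1 :> R)//; field.
have lo : c 2^-1 - c y <= 0.
  have := derive_cmp y2 (fun x _ => dc x) (fun x _ => derive_cst 0 x).
  by rewrite subrr; apply=> t /dc_bnd/andP[].
have hi : - e * 2^-1 - - e * y <= c 2^-1 - c y.
  have dl (x : R) : y <= x <= 2^-1 -> is_derive x 1 (fun t => - e * t) (- e).
    move=> _; have /is_derive_eq := derive_mul (derive_cst (- e) x) (derive_id x).
    by apply; ring.
  by apply: (derive_cmp y2 dl (fun x _ => dc x)) => t /dc_bnd/andP[].
rewrite -/(c y); have := V1_le; have := V_ge0 hw 1; have := far_ratio_gt0.
by nra.
Qed.

Lemma Rw_half_V0 : V 0 / 2 <= Rw 2^-1 <= V 0 / 2 + e.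
Proof.
have y0 : 0 <= 2^-1 :> R by lra.
have RE : Rw 2^-1 = F 1 by rewrite (wp_RE hw) subrr (wp_F0 hw) subr0; congr F; field.
pose c t := F (t + 2^-1) - F (2^-1 - t).
have dc (x : R) : is_derive x 1 c (V (2^-1 + x) + V (2^-1 - x)).
  have d1 := derive_shift (wp_F hw (x + 2^-1)).
  have d2 := derive_opp (derive_reflect (wp_F hw (2^-1 - x))).
  by have /is_derive_eq := derive_add d1 d2; apply; rewrite opprK (addrC x).
have cE : c 2^-1 - c 0 = Rw 2^-1.
  by rewrite RE /c subrr (wp_F0 hw) add0r !subr0 subrr subr0; congr F; field.
have dl k (x : R) : 0 <= x <= 2^-1 -> is_derive x 1 (fun t => k * t) k.
  by move=> _; have /is_derive_eq := derive_mul (derive_cst k x) (derive_id x); apply; ring.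
have refl (x : R) : 0 < x < 2^-1 -> V 0 <= V (2^-1 + x) + V (2^-1 - x) <= V 0 + 2 * e.
  by move=> ?; apply: V_reflection; lra.
apply/andP; split.
  have := derive_cmp y0 (dl (V 0)) (fun x _ => dc x) (fun x h => proj1 (andP (refl x h))).
  by rewrite cE; lra.
have := derive_cmp y0 (fun x _ => dc x) (dl (V 0 + 2 * e)) (fun x h => proj2 (andP (refl x h))).
by rewrite cE; lra.
Qed.

(** The derivative of the gap [1 - Rw], as [derive_gap] shows. *)
Definition gap_slope x := V (x - 2^-1) - V (x + 2^-1).

(** Parallelogram identity for [V (1/2 + x)] and [V (1/2 - x)]: up to sign their difference is
    [gap_slope x], their sum is nearly [V 0], and over [0, 1/2] their squares exhaust [V ^ 2] on
    [0, 1]. *)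
Lemma W1_slope (I : R -> R) : I 0 = 0 ->
  (forall x : R, is_derive x 1 I (gap_slope x ^+ 2)) ->
  V 0 ^+ 2 / 2 <= 2 * W 1 - I 2^-1 <= (V 0 + 2 * e) ^+ 2 / 2.
Proof.
move=> I0 dI; have y0 : 0 <= 2^-1 :> R by lra.
pose c t := 2 * (W (t + 2^-1) - W (2^-1 - t)) - I t.
have dc (x : R) : is_derive x 1 c ((V (2^-1 + x) + V (2^-1 - x)) ^+ 2).
  have d1 := derive_shift (wp_W hw (x + 2^-1)).
  have d2 := derive_opp (derive_reflect (wp_W hw (2^-1 - x))).
  have d3 := derive_mul (derive_cst 2 x) (derive_add d1 d2).
  have /is_derive_eq := derive_add d3 (derive_opp (dI x)); apply.
  rewrite /gap_slope -(np_even (wp_V hw) (x - 2^-1)) opprB (addrC 2^-1 x); ring.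
have cE : c 2^-1 - c 0 = 2 * W 1 - I 2^-1.
  by rewrite /c subrr (wp_W0 hw) I0 add0r !subr0 subrr mulr0 subr0; congr (2 * W _ - _); field.
have dl k (x : R) : 0 <= x <= 2^-1 -> is_derive x 1 (fun t => k * t) k.
  by move=> _; have /is_derive_eq := derive_mul (derive_cst k x) (derive_id x); apply; ring.
have refl (x : R) : 0 < x < 2^-1 ->
    V 0 ^+ 2 <= (V (2^-1 + x) + V (2^-1 - x)) ^+ 2 <= (V 0 + 2 * e) ^+ 2.
  move=> /andP[x0 x2]; have /andP[lo hi] := @V_reflection x ltac:(lra).
  have v0 := V_ge0 hw 0; have e0 := far_ratio_gt0.
  by rewrite !ler_pXn2r ?nnegrE//; lra.
apply/andP; split.
  have := derive_cmp y0 (dl (V 0 ^+ 2)) (fun x _ => dc x) (fun x h => proj1 (andP (refl x h))).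
  by rewrite cE; lra.
have := derive_cmp y0 (fun x _ => dc x) (dl ((V 0 + 2 * e) ^+ 2)) (fun x h => proj2 (andP (refl x h))).
by rewrite cE; lra.
Qed.

End WaveDecay.

(** * Approximate conservation of energy for the gap *)

Section WaveEnergy.
Context {R : realType} (m : R) (V Rw : R -> R) (sigma N : R) (F G W : R -> R).
Context (hw : wave_primitives m V Rw sigma N F G W).

Let eps := 1 - Rw 0.
Let L := far_bound m.
Let slope := gap_slope V.

Context (e8 : eps <= 8^-1).

Definition gap x := 1 - Rw x.

Lemma derive_gap (x : R) : is_derive x 1 gap (slope x).
Proof.
have /is_derive_eq := derive_add (derive_cst 1 x) (derive_opp (derive_Rw hw x)).
by apply; rewrite /slope /gap_slope; ring.
Qed.

Lemma derive_slope (x : R) : is_derive x 1 slope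
  ((2 * dPhi m (Rw x) - dPhi m (Rw (1 - x)) - dPhi m (Rw (x + 1))) / sigma).
Proof.
have s0 := wp_sigma hw.
have d1 := derive_shift (derive_V hw (x - 2^-1)).
have d2 := derive_opp (derive_shift (derive_V hw (x + 2^-1))).
have /is_derive_eq := derive_add d1 d2; apply.
rewrite (_ : x + 2^-1 + 2^-1 = x + 1); last by field.
rewrite (_ : x + 2^-1 - 2^-1 = x); last by field.
rewrite (_ : x - 2^-1 + 2^-1 = x); last by field.
rewrite (_ : x - 2^-1 - 2^-1 = - (1 - x)); last by field.
by rewrite (np_even (wp_R hw)); field; lra.
Qed.

Lemma gap_gt0 x : 0 < gap x.
Proof. by rewrite /gap; have := wp_lt1 hw x; lra. Qed.

Lemma gap_le1 x : gap x <= 1.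
Proof. by rewrite /gap; have := Rw_ge0 hw x; lra. Qed.

Lemma slope0 : slope 0 = 0.
Proof. by rewrite /slope /gap_slope !add0r (np_even (wp_V hw)) subrr. Qed.

Lemma slope_half : slope 2^-1 = V 0 - V 1.
Proof. by rewrite /slope /gap_slope subrr (_ : 2^-1 + 2^-1 = 1 :> R)//; field. Qed.

Lemma slope_ge0 x : 0 <= x <= 2^-1 -> 0 <= slope x.
Proof.
move=> /andP[x0 x2]; rewrite /slope /gap_slope -(np_even (wp_V hw) (x - 2^-1)) opprB.
by rewrite subr_ge0; apply: (np_le (wp_V hw)); lra.
Qed.

Lemma slope_le2 x : 0 <= x <= 2^-1 -> slope x <= 2.
Proof.
move=> /andP[x0 x2]; rewrite /slope /gap_slope -(np_even (wp_V hw) (x - 2^-1)) opprB.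
have := np_le (wp_V hw) (lexx 0) (y := 2^-1 - x) ltac:(lra).
by have := V0_le2 hw; have := V_ge0 hw (x + 2^-1); lra.
Qed.

(** Strictness keeps the comparison away from 0, where the inverse of [S] is not differentiable. If
    it failed, monotonicity would make [Rw] constant on [0, x]; there [slope] has positive
    derivative, since [Rw 0 >= 7/8] exceeds the values [<= 3/4] at [1 - t] and [t + 1], so [gap]
    would strictly increase. *)
Lemma gap_gt_eps x : 0 < x <= 2^-1 -> eps < gap x.
Proof.
move=> /andP[x0 x2]; rewrite ltNge; apply/negP => gx.
have m0 := wave_m_gt0 hw; have s0 := wp_sigma hw.
have flat t : 0 <= t <= x -> Rw t = Rw 0.
  move=> /andP[t0 tx]; apply/eqP; rewrite eq_le (np_le (wp_R hw))//=.
  apply: le_trans (np_le (wp_R hw) t0 tx).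
  by move: gx; rewrite /gap /eps; lra.
have dslope_gt0 t : 0 <= t <= x ->
  0 < (2 * dPhi m (Rw t) - dPhi m (Rw (1 - t)) - dPhi m (Rw (t + 1))) / sigma.
  move=> tx; apply: divr_gt0 => //; rewrite flat//.
  have R1 := wp_lt1 hw 0.
  have e8' : 1 - Rw 0 <= 8^-1 := e8.
  have far1 := Rw_far hw e8 (x := 1 - t) ltac:(lra).
  have far2 := Rw_far hw e8 (x := t + 1) ltac:(lra).
  have := @dPhi_lt R m (Rw (1 - t)) (Rw 0) m0 ltac:(lra) R1.
  have := @dPhi_lt R m (Rw (t + 1)) (Rw 0) m0 ltac:(lra) R1.
  lra.
have slope_gt0 t : 0 < t <= x -> 0 < slope t.
  move=> /andP[t0 tx]; rewrite -slope0.
  apply: (derive_lt t0 (fun u _ => derive_slope u)) => u ut.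
  by apply: dslope_gt0; lra.
have : gap 0 < gap x.
  apply: (derive_lt x0 (fun u _ => derive_gap u)) => u ux.
  by apply: slope_gt0; lra.
by rewrite (_ : gap 0 = eps)//; lra.
Qed.

(** The energy has derivative [- slope * rest] with [0 <= rest <= K / sigma]; the part [4 / (m + 1)]
    of [K] stems from the constant [- 1] in [dPhi]. As [slope] is the derivative of [gap], the loss
    integrates to at most [K / sigma * (gap x - eps)], which vanishes at 0 as [slope] does. *)
Lemma energy_bounds x : 0 <= x <= 2^-1 ->
  4 / (m * (m + 1)) / sigma * (eps `^ (- m) - gap x `^ (- m))
    - (4 / (m + 1) + 4 * L) / sigma * (gap x - eps)
  <= slope x ^+ 2 <=
  4 / (m * (m + 1)) / sigma * (eps `^ (- m) - gap x `^ (- m)).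
Proof.
move=> /andP[x0 x2]; have m0 := wave_m_gt0 hw; have s0 := wp_sigma hw.
set K := _ + 4 * L; set A := _ / sigma.
pose E t := slope t ^+ 2 + A * gap t `^ (- m).
pose rest t := (4 / (m + 1) + 2 * dPhi m (Rw (1 - t)) + 2 * dPhi m (Rw (t + 1))) / sigma.
have dE (t : R) : is_derive t 1 E (- (slope t * rest t)).
  have d1 := derive_sqr (derive_slope t).
  have d2 := derive_mul (derive_cst A t) (derive_powR (- m) (derive_gap t) (gap_gt0 t)).
  have /is_derive_eq := derive_add d1 d2; apply.
  rewrite /rest /A {1}/dPhi -[1 - Rw t]/(gap t) (_ : - (m + 1) = - m - 1); last by ring.
  by field; rewrite !gt_eqF//=; lra.
have E0 : E 0 = A * eps `^ (- m) by rewrite /E slope0 expr0n/= add0r.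
have slope0' t : 0 < t < x -> 0 <= slope t by move=> ?; apply: slope_ge0; lra.
have rest_bnd t : 0 < t < x -> 0 <= rest t <= K / sigma.
  move=> tx.
  have a1 := dPhi_Rw_ge0 hw (1 - t); have a2 := dPhi_Rw_ge0 hw (t + 1).
  have b1 := dPhi_far_le hw e8 (x := 1 - t) ltac:(lra).
  have b2 := dPhi_far_le hw e8 (x := t + 1) ltac:(lra).
  have : 0 < 4 / (m + 1) by apply: divr_gt0; lra.
  by rewrite /rest /K ler_pM2r ?invr_gt0// /L pmulr_lge0 ?invr_gt0//; lra.
apply/andP; split.
  have dk (t : R) : is_derive t 1 (fun t => - (K / sigma * gap t)) (- (K / sigma * slope t)).
    have /is_derive_eq := derive_opp (derive_mul (derive_cst (K / sigma) t) (derive_gap t)).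
    by apply; ring.
  have := derive_cmp x0 (fun t _ => dk t) (fun t _ => dE t).
  have e0E : gap 0 = eps by [].
  rewrite E0 e0E /E => H; rewrite -subr_ge0.
  suff /H : forall t, 0 < t < x -> - (K / sigma * slope t) <= - (slope t * rest t).
    by lra.
  move=> t tx; have /andP[_ r1] := rest_bnd t tx; have := slope0' t tx.
  by rewrite lerN2 mulrC => ?; apply: ler_wpM2r.
have := derive_cmp x0 (fun t _ => dE t) (fun t _ => derive_cst 0 t).
rewrite subrr E0 /E => H.
suff /H : forall t, 0 < t < x -> - (slope t * rest t) <= 0 by lra.
move=> t tx; have /andP[r0 _] := rest_bnd t tx; have := slope0' t tx.
by rewrite oppr_le0 => ?; apply: mulr_ge0.
Qed.

End WaveEnergy.

(** * The limit profile: first integral, asymptotics and inverse *)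

Section PowerTail.
Context {R : realType}.
Implicit Types (f F : R -> R) (C m t : R).

(** The primitive of [C * x ^ -m] bounds what [F] can still gain after [t]: at [t = 1] this yields
    convergence, at general [t] the rate. *)
Lemma halfline_integral_tail f F C m : 1 < m -> 0 <= C -> continuous f ->
  (forall x, 0 <= x -> 0 <= f x) -> (forall x, 1 <= x -> f x <= C * x `^ (- m)) ->
  (forall x : R, is_derive x 1 F (f x)) -> F 0 = 0 -> forall t, 1 <= t ->
  0 <= \int[@lebesgue_measure R]_(x in `[0, +oo[) f x - F t
    <= C / (m - 1) * t `^ (1 - m).
Proof.
move=> m1 C0 cf f0 fC dF F0 t t1.
have ndF x y : 0 <= x -> x <= y -> F x <= F y.
  move=> x0 xy; apply: (derive_le xy (fun z _ => dF z)) => z /andP[xz _].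
  by apply: f0; lra.
pose B t : R := C / (m - 1) * t `^ (1 - m).
have B0 x : 0 <= B x by rewrite /B !mulr_ge0 ?invr_ge0 ?powR_ge0//; lra.
have tail x y : 1 <= x -> x <= y -> F y <= F x + B x.
  move=> x1 xy; have dB (z : R) : x <= z <= y -> is_derive z 1 (fun t => - B t) (C * z `^ (- m)).
    move=> /andP[xz _]; have z0 : 0 < z by lra.
    have d := derive_powR (f := fun t => t) (1 - m) (derive_id z) z0.
    have /is_derive_eq := derive_opp (derive_mul (derive_cst (C / (m - 1)) z) d); apply.
    by rewrite (_ : 1 - m - 1 = - m); [field; lra|ring].
  have := derive_cmp xy (fun z _ => dF z) dB.
  have := B0 y => By H; suff : F y - F x <= - B y - - B x by lra.
  by apply: H => z /andP[xz _]; apply: fC; lra.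
have bnd u x : 1 <= u -> 0 <= x -> F x <= F u + B u.
  move=> u1 x0; have [xu|/ltW xu] := leP x u; last exact: tail.
  by have := ndF _ _ x0 xu; have := B0 u; lra.
have [l [_ Fl E lB]] := nonneg_integral_halfline cf f0 dF (bnd _ ^~ (lexx 1)).
rewrite /Rintegral E /= F0 subr0.
have := Fl t ltac:(lra); have := lB _ (bnd _ ^~ t1).
by rewrite -/(B t); lra.
Qed.

End PowerTail.

Section Profile.
Context {R : realType} (m : R) (S : R -> R).
Context (m1 : 1 < m) (hS : limit_profile m S).

Let S1 : R -> R := S^`().
Let S2 x := 2 / (m + 1) * (1 + S x) `^ (- (m + 1)).
Let mub := mu_bar m.

Lemma mu_bar_gt0 : 0 < mub.
Proof.
have m1' := m1.
by rewrite divr_gt0 ?sqrtr_gt0 ?mulr_gt0//; lra. Qed.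

Lemma mu_bar_sqr : mub ^+ 2 = 4 / (m * (m + 1)).
Proof.
have m1' := m1.
rewrite /mub /mu_bar expr_div_n sqr_sqrtr; last by rewrite mulr_ge0; lra.
by congr (_ / _); ring.
Qed.

Lemma profile_base_gt0 x : 0 < 1 + S x.
Proof. by have := lp_gtN1 hS x; lra. Qed.

Lemma derive_profile (x : R) : is_derive x 1 S (S1 x).
Proof. exact/is_derive_derivable/(lp_derivable hS). Qed.

Lemma profile_second : S^`(2) = S2.
Proof. by apply/funext => x; rewrite (lp_ode hS). Qed.

Lemma derive_profile1 (x : R) : is_derive x 1 S1 (S2 x).
Proof.
rewrite -profile_second.
have d : derivable S1 x 1 := @lp_derivable2 R m S hS x.
exact: is_derive_derivable d.
Qed.

Lemma profile_second_gt0 x : 0 < S2 x.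
Proof.
have m1' := m1.
by rewrite /S2 mulr_gt0 ?divr_gt0 ?powR_gt0 ?profile_base_gt0//; lra.
Qed.

Lemma continuous_profile_second : continuous S2.
Proof.
have m1' := m1.
move=> x.
have db := derive_add (derive_cst 1 x) (derive_profile x).
have dp := derive_powR (- (m + 1)) db (profile_base_gt0 x).
exact: is_derive_continuous (derive_mul (derive_cst (2 / (m + 1)) x) dp).
Qed.

(** First integral of the profile equation. For [gap = eps * (1 + S)] it is, up to the factor
    [b ^ 2], the upper bound of [energy_bounds]. *)
Lemma profile_energy x : S1 x ^+ 2 = mub ^+ 2 * (1 - (1 + S x) `^ (- m)).
Proof.
have m1' := m1.
pose E t := S1 t ^+ 2 + mub ^+ 2 * (1 + S t) `^ (- m).
have dE (t : R) : is_derive t 1 E 0.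
  have db := derive_add (derive_cst 1 t) (derive_profile t).
  have dp := derive_powR (- m) db (profile_base_gt0 t).
  have /is_derive_eq :=
    derive_add (derive_sqr (derive_profile1 t)) (derive_mul (derive_cst (mub ^+ 2) t) dp).
  apply; rewrite mu_bar_sqr /S2 (_ : - (m + 1) = - m - 1); last by ring.
  by field; rewrite !gt_eqF//=; lra.
have := is_derive_0_is_cst (f := E) x 0 dE.
rewrite /E (lp_init hS) /S1 (lp_init' hS) addr0 powR1 expr0n/= add0r mulr1 -/S1.
by lra.
Qed.

Lemma profile1_le x y : x <= y -> S1 x <= S1 y.
Proof.
move=> xy; apply: (derive_le xy (fun t _ => derive_profile1 t)) => t _.
exact/ltW/profile_second_gt0.
Qed.

Lemma profile1_gt0 x : 0 < x -> 0 < S1 x.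
Proof.
move=> x0; rewrite -(lp_init' hS) -/S1.
by apply: (derive_lt x0 (fun t _ => derive_profile1 t)) => t _; apply: profile_second_gt0.
Qed.

Lemma profile1_ge0 x : 0 <= x -> 0 <= S1 x.
Proof. by move=> /profile1_le; rewrite {1}/S1 (lp_init' hS). Qed.

Lemma profile_lt x y : 0 <= x -> x < y -> S x < S y.
Proof.
move=> x0 xy; apply: (derive_lt xy (fun t _ => derive_profile t)) => t /andP[xt _].
by apply: profile1_gt0; lra.
Qed.

Lemma profile_gt0 x : 0 < x -> 0 < S x.
Proof. by move=> /(profile_lt (lexx 0)); rewrite (lp_init hS). Qed.

Lemma profile_ge0 x : 0 <= x -> 0 <= S x.
Proof. by rewrite le_eqVlt => /predU1P[<-|/profile_gt0/ltW//]; rewrite (lp_init hS). Qed.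

Lemma profile1_le_mu_bar x : 0 <= x -> S1 x <= mub.
Proof.
move=> x0; rewrite -(@ler_pXn2r _ 2)// ?nnegrE ?profile1_ge0// ?(ltW mu_bar_gt0)//.
rewrite profile_energy; have := powR_ge0 (1 + S x) (- m); have := sqr_ge0 mub; nra.
Qed.

Lemma profile_le_linear x : 0 <= x -> S x <= mub * x.
Proof.
move=> x0; have dl (t : R) : is_derive t 1 (fun t => mub * t) mub.
  by have /is_derive_eq := derive_mul (derive_cst mub t) (derive_id t); apply; ring.
have := derive_cmp x0 (fun t _ => derive_profile t) (fun t _ => dl t).
rewrite (lp_init hS) mulr0 !subr0; apply => t /andP[t0 _].
by apply: profile1_le_mu_bar; lra.
Qed.

(** This primitive vanishes at 0 and tends to [kappa_bar S]; so [kappa] is the offset of the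
    asymptote [mub * t - kappa] of [S]. *)
Lemma derive_legendre (x : R) : is_derive x 1 (fun t => t * S1 t - S t) (x * S2 x).
Proof.
have /is_derive_eq := derive_add (derive_mul (derive_id x) (derive_profile1 x))
  (derive_opp (derive_profile x)).
by apply; ring.
Qed.

(** By convexity the slope at 1, and thus beyond, is at least [S 1]. This linear bound turns
    negative powers of [1 + S] into negative powers of [x]. *)
Lemma profile_ge_linear x : 1 <= x -> S 1 * x <= S x.
Proof.
move=> x1.
have S11 : S 1 <= S1 1.
  have := derive_le (ler01 : 0 <= 1 :> R) (fun t _ => derive_legendre t).
  rewrite mul0r mul1r (lp_init hS) => H; suff : 0 - 0 <= S1 1 - S 1 by lra.
  by apply: H => t /andP[/ltW t0 _]; apply: mulr_ge0 => //; exact/ltW/profile_second_gt0.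
have dl (t : R) : is_derive t 1 (fun t => S 1 * t) (S 1).
  by have /is_derive_eq := derive_mul (derive_cst (S 1) t) (derive_id t); apply; ring.
have := derive_cmp x1 (fun t _ => dl t) (fun t _ => derive_profile t).
rewrite mulr1 => H; suff : S 1 * x - S 1 <= S x - S 1 by lra.
by apply: H => t /andP[t1 _]; have := profile1_le (ltW t1); lra.
Qed.

Lemma profile_power_le p x : 0 <= p -> 1 <= x ->
  (1 + S x) `^ (- p) <= S 1 `^ (- p) * x `^ (- p).
Proof.
have m1' := m1.
move=> p0 x1; have s1 := profile_gt0 (ltr01 : 0 < 1 :> R).
rewrite -powRM; [|lra|lra].
apply: powRN_le => //; first by rewrite mulr_gt0//; lra.
by have := profile_ge_linear x1; lra.
Qed.

(** Integration by parts: [t * S' - S] and [S * S' - M] are primitives of [t * S''] and [S * S''],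
    with limits [kappa] and [eta]; [S' -> mub] then gives both asymptotes. The errors are the
    integral tails, and [mub - S' <= mub * (1 + S) ^ -m], of order [t ^ -m], multiplied by [t] or
    [S]. *)
Lemma profile_asymptotics : exists C (M : R -> R),
  [/\ 0 <= C,
      forall t, 1 <= t -> `|S t - (mub * t - kappa_bar S)| <= C * t `^ (1 - m),
      forall t, 1 <= t -> mub - S1 t <= C * t `^ (- m),
      M 0 = 0 /\ (forall t : R, is_derive t 1 M (S1 t ^+ 2)) &
      forall t, 1 <= t ->
        `|M t - (mub ^+ 2 * t - mub * kappa_bar S - eta_bar S)| <= C * t `^ (1 - m)].
Proof.
have m1' := m1.
have s1 := profile_gt0 (ltr01 : 0 < 1 :> R); have mub0 := mu_bar_gt0.
have cS : continuous S by move=> x; exact: is_derive_continuous (derive_profile x).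
pose C2 := 2 / (m + 1) * S 1 `^ (- (m + 1)).
have C20 : 0 <= C2 by rewrite !mulr_ge0 ?invr_ge0 ?powR_ge0//; lra.
have S2C t : 1 <= t -> t * S2 t <= C2 * t `^ (- m).
  move=> t1; have := profile_power_le (p := m + 1) ltac:(lra) t1.
  have -> : t `^ (- m) = t * t `^ (- (m + 1)).
    rewrite (_ : - m = 1 + - (m + 1)); last by ring.
    rewrite powRD ?powRr1//; first by lra.
    by apply/implyP => _; lra.
  have c0 : 0 < t * (2 / (m + 1)) by rewrite mulr_gt0 ?divr_gt0//; lra.
  by move/(ler_wpM2l (ltW c0)); rewrite /S2 /C2; lra.
have ctS2 : continuous (fun x : R => x * S2 x).
  by move=> x; apply: cvgM; [exact: cvg_id|exact: continuous_profile_second].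
have cSS2 : continuous (fun x : R => S x * S2 x).
  by move=> x; apply: cvgM; [exact: cS|exact: continuous_profile_second].
have [Nn [Nn0 dNn]] := continuous_primitive cSS2.
have tS2_ge0 x : 0 <= x -> 0 <= x * S2 x.
  by move=> x0; apply: mulr_ge0 => //; exact/ltW/profile_second_gt0.
have SS2_ge0 x : 0 <= x -> 0 <= S x * S2 x.
  by move=> x0; apply: mulr_ge0; [exact: profile_ge0|exact/ltW/profile_second_gt0].
have SS2C t : 1 <= t -> S t * S2 t <= mub * C2 * t `^ (- m).
  move=> t1; have := ler_wpM2l (ltW mub0) (S2C t t1) => H.
  apply: (@le_trans _ _ (mub * t * S2 t)); last by lra.
  by apply: ler_wpM2r; [exact/ltW/profile_second_gt0|apply: profile_le_linear; lra].
have kappaT := halfline_integral_tail m1 C20 ctS2 tS2_ge0 S2C derive_legendre.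
have etaT := halfline_integral_tail m1 (mulr_ge0 (ltW mub0) C20) cSS2 SS2_ge0 SS2C dNn Nn0.
pose c1 := C2 / (m - 1); pose c3 := mub * S 1 `^ (- m).
have c10 : 0 <= c1 by rewrite divr_ge0//; lra.
have c30 : 0 <= c3 by rewrite mulr_ge0 ?powR_ge0// ltW.
have S1C t : 1 <= t -> 0 <= mub - S1 t <= c3 * t `^ (- m).
  move=> t1; have lo := profile1_le_mu_bar (x := t) ltac:(lra).
  have s0 := profile1_ge0 (x := t) ltac:(lra).
  have := profile_power_le (p := m) ltac:(lra) t1; have := profile_energy t => E P.
  apply/andP; split; first by lra.
  rewrite -(ler_pM2l mub0) /c3; apply: (@le_trans _ _ (mub ^+ 2 * (1 + S t) `^ (- m))).
    by nra.
  by have := ler_wpM2l (exprn_ge0 2 (ltW mub0)) P; lra.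
have powS t : 1 <= t -> t `^ (1 - m) = t * t `^ (- m).
  move=> t1; rewrite powRD ?powRr1//; first by lra.
  by apply/implyP => _; lra.
have kappaE : kappa_bar S = \int[@lebesgue_measure R]_(x in `[0, +oo[) (x * S2 x).
  by rewrite /kappa_bar profile_second.
have etaE : eta_bar S = \int[@lebesgue_measure R]_(x in `[0, +oo[) (S x * S2 x).
  by rewrite /eta_bar profile_second.
have ST t : 1 <= t -> `|S t - (mub * t - kappa_bar S)| <= (c1 + c3) * t `^ (1 - m).
  move=> t1; have := kappaT _ t t1; rewrite -kappaE (lp_init hS) mul0r subrr.
  move=> /(_ erefl) /andP[k1 k2]; have /andP[u1 u2] := S1C t t1.
  have t0 : 0 < t by lra.
  rewrite ler_norml powS//; move: k2; rewrite -/c1 powS// => k2.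
  have p0 := powR_ge0 t (- m); have := ler_wpM2l (ltW t0) u2.
  have tp0 := mulr_ge0 (ltW t0) p0.
  have := mulr_ge0 c10 tp0; have := mulr_ge0 c30 tp0; have := mulr_ge0 (ltW t0) u1.
  by lra.
exists (c1 + c3 + (mub * (c1 + c3) + mub * c3 + mub * c1)), (fun t => S t * S1 t - Nn t).
have c130 := addr_ge0 c10 c30.
have q0 : 0 <= mub * (c1 + c3) + mub * c3 + mub * c1.
  by have := mulr_ge0 (ltW mub0) c130; have := mulr_ge0 (ltW mub0) c10; have := mulr_ge0 (ltW mub0) c30; lra.
split.
- by rewrite addr_ge0.
- move=> t t1; apply: le_trans (ST t t1) _.
  by rewrite ler_wpM2r ?powR_ge0//; lra.
- move=> t t1; have /andP[_ u] := S1C t t1; apply: le_trans u _.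
  by rewrite ler_wpM2r ?powR_ge0//; lra.
- split; first by rewrite (lp_init hS) mul0r Nn0 subrr.
  move=> t; have /is_derive_eq := derive_add
    (derive_mul (derive_profile t) (derive_profile1 t)) (derive_opp (dNn t)).
  by apply; ring.
- move=> t t1; have := ST t t1; have := etaT t t1; rewrite -etaE.
  have /andP[u1 u2] := S1C t t1; have t0 : 0 < t by lra.
  have Sl := profile_le_linear (ltW t0); have S0 := profile_ge0 (ltW t0).
  rewrite -(mulrA mub C2) -/c1 !ler_norml; set p := t `^ (1 - m).
  move=> /andP[n1 n2] /andP[].
  have p0 : 0 <= p by apply: powR_ge0.
  move=> /(ler_wpM2l (ltW mub0)) st1 /(ler_wpM2l (ltW mub0)) st2.
  have a1 : 0 <= S t * (mub - S1 t) by rewrite mulr_ge0.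
  have a2 : S t * (mub - S1 t) <= mub * c3 * p.
    apply: le_trans (ler_wpM2r u1 Sl) _.
    have := ler_wpM2l (mulr_ge0 (ltW mub0) (ltW t0)) u2.
    by rewrite /p powS//; lra.
  have b1 : 0 <= c1 * p by rewrite mulr_ge0.
  have b2 : 0 <= c3 * p by rewrite mulr_ge0.
  have b3 : 0 <= mub * (c1 * p) by apply: (mulr_ge0 (ltW mub0)); exact: mulr_ge0.
  have b4 : 0 <= mub * (c3 * p) by apply: (mulr_ge0 (ltW mub0)); exact: mulr_ge0.
  by apply/andP; split; lra.
Qed.

End Profile.

Section ProfileInverse.
Context {R : realType} (m : R) (S : R -> R).
Context (m1 : 1 < m) (hS : limit_profile m S).

Lemma profile_surjective s : 0 <= s -> exists2 t, 0 <= t & S t = s.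
Proof.
move=> s0; have s1 : 0 < S 1 by apply: (profile_gt0 m1 hS).
pose T := 1 + s / S 1.
have T1 : 1 <= T by rewrite /T lerDl divr_ge0// ltW.
have ST : s <= S T.
  apply: le_trans (profile_ge_linear m1 hS T1).
  by rewrite /T mulrDr mulr1 mulrC divfK ?gt_eqF// lerDr ltW.
have [||c] := @IVT R S 0 T s ltac:(lra).
- by apply: derivable_within_continuous => x _; apply: (lp_derivable hS).
- by rewrite (lp_init hS) minElt maxElt; do 2 case: ltP; lra.
by rewrite in_itv/= => /andP[c0 _] <-; exists c.
Qed.

Lemma profile_inverse : exists g : R -> R,
  [/\ forall s : R, 0 <= s -> 0 <= g s, forall s : R, 0 <= s -> S (g s) = s,
      forall t : R, 0 <= t -> g (S t) = t &
      forall s : R, 0 < s -> is_derive s 1 g ((S^`())%classic (g s))^-1].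
Proof.
have ex s : exists t, 0 <= s -> 0 <= t /\ S t = s.
  have [s0|_] := leP 0 s; last by exists 0.
  by have [t t0 St] := profile_surjective s0; exists t.
have [g gP] := choice ex.
have gK t : 0 <= t -> g (S t) = t.
  move=> t0; have [g0 Sg] := gP _ (profile_ge0 m1 hS t0).
  apply/eqP; rewrite eq_le !leNgt; apply/andP; split; apply/negP => lt.
    by have := profile_lt m1 hS t0 lt; rewrite Sg ltxx.
  by have := profile_lt m1 hS g0 lt; rewrite Sg ltxx.
exists g; split => //; try by move=> s /gP[].
move=> s s0; have [g0 Sg] := gP s (ltW s0).
have g0' : 0 < g s.
  rewrite lt_neqAle g0 andbT; apply/eqP => E.
  by move: s0; rewrite -Sg -E (lp_init hS) ltxx.
rewrite -{1}Sg; apply: is_derive_inverse.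
- near=> t; apply: gK; apply: ltW; near: t; exact: lt_nbhsr.
- near=> t; exact: is_derive_continuous (derive_profile hS t).
- exact: derive_profile hS (g s).
- by rewrite gt_eqF// (profile1_gt0 m1 hS).
Unshelve. all: by end_near. Qed.

End ProfileInverse.

(** The form in which the starting point of the comparison is sent to 0. *)
Lemma le_of_linear_error {R : realType} (x y c : R) : 0 <= c ->
  (forall e, 0 < e -> x <= y + c * e) -> x <= y.
Proof.
move=> c0 H; apply/ler_addgt0Pr => e e0.
have c1 : 0 < c + 1 by lra.
have := H (e / (c + 1)) (divr_gt0 e0 c1) => /le_trans; apply.
rewrite lerD2l mulrA ler_pdivrMr//; nra.
Qed.

(** * Comparison of an abstract gap [Q] with the rescaled profile *)

Section Comparison.
Context {R : realType} (m : R) (S M : R -> R).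
Context (m1 : 1 < m) (hS : limit_profile m S).
Context (M0 : M 0 = 0) (dM : forall t : R, is_derive t 1 M (((S^`())%classic t) ^+ 2)).
Context (Q sl I : R -> R) (eps b k : R).
Context (eps0 : 0 < eps) (b0 : 0 < b) (k01 : 0 <= k <= 1).
Context (Q0 : Q 0 = eps) (dQ : forall x : R, is_derive x 1 Q (sl x)).
Context (Q_gt : forall x, 0 < x <= 2^-1 -> eps < Q x).
Context (sl_ge0 : forall x, 0 <= x <= 2^-1 -> 0 <= sl x <= 2).
Context (I0 : I 0 = 0) (dI : forall x : R, is_derive x 1 I (sl x ^+ 2)).

Let S1 : R -> R := S^`().
Let mub := mu_bar m.

Context (sl_bounds : forall x, 0 <= x <= 2^-1 ->
  (1 - k) * (mub ^+ 2 * b ^+ 2 * (1 - (Q x / eps) `^ (- m))) <= sl x ^+ 2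
    <= mub ^+ 2 * b ^+ 2 * (1 - (Q x / eps) `^ (- m))).

Lemma profile_action_bounds t : 0 <= t -> 0 <= M t <= mub ^+ 2 * t.
Proof.
move=> t0; apply/andP; split.
  by rewrite -M0; apply: (derive_le t0 (fun x _ => dM x)) => x _; apply: sqr_ge0.
have dl (x : R) : is_derive x 1 (fun t => mub ^+ 2 * t) (mub ^+ 2).
  by have /is_derive_eq := derive_mul (derive_cst (mub ^+ 2) x) (derive_id x); apply; ring.
have := derive_cmp t0 (fun x _ => dM x) (fun x _ => dl x).
rewrite M0 mulr0 !subr0; apply => x /andP[/ltW x0 _].
rewrite ler_pXn2r ?nnegrE//; first exact: profile1_le_mu_bar.
  exact: profile1_ge0 m1 hS _ x0.
exact/ltW/mu_bar_gt0.
Qed.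

(* [tau] is the profile time of [Q]: [Q = eps * (1 + S tau)], so that the
   energy bounds say that [tau'] lies between [(1 - k) * b / eps] and [b / eps]. *)
Lemma profile_time_bounds : exists2 T, 0 <= T &
  [/\ Q 2^-1 = eps * (1 + S T),
      (1 - k) * (b / (2 * eps)) <= T <= b / (2 * eps),
      (1 - k) * (b * S1 T) <= sl 2^-1 <= b * S1 T &
      (1 - k) * (b * eps * M T) <= I 2^-1 <= b * eps * M T].
Proof.
have eps0' := eps0; have b0' := b0; have /andP[k0 k1] := k01.
have be0 : 0 < b / eps by apply: divr_gt0.
have mub0 := mu_bar_gt0 m1.
have [g [g0 Sg gK dg]] := profile_inverse m1 hS.
pose z x := Q x / eps - 1; pose tau x := g (z x).
have half : 0 < (2^-1 : R) <= 2^-1 by lra.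
have z0 x : 0 < x <= 2^-1 -> 0 < z x.
  by move=> /Q_gt Qx; rewrite /z subr_gt0 ltr_pdivlMr ?mul1r.
have tau0 x : 0 < x <= 2^-1 -> 0 <= tau x by move=> /z0/ltW/g0.
have Stau x : 0 < x <= 2^-1 -> 1 + S (tau x) = Q x / eps.
  by move=> /z0/ltW/Sg; rewrite /tau => ->; rewrite /z; ring.
have tau_gt0 x : 0 < x <= 2^-1 -> 0 < tau x.
  move=> hx; rewrite lt_neqAle tau0// andbT; apply/eqP => E.
  by have := z0 _ hx; rewrite -(Sg _ (ltW (z0 _ hx))) -/(tau x) -E (lp_init hS) ltxx.
have S1tau x : 0 < x <= 2^-1 -> 0 < S1 (tau x).
  by move=> /tau_gt0; apply: profile1_gt0 m1 hS _.
have slS x : 0 < x <= 2^-1 -> (1 - k) * (b * S1 (tau x)) <= sl x <= b * S1 (tau x).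
  move=> hx; have S1x := S1tau x hx; have := profile_energy m1 hS (tau x).
  rewrite Stau// -/S1 -/mub => E.
  have [hx1 hx2] : 0 <= x <= 2^-1 /\ 0 <= sl x.
    by have hx' : 0 <= x <= 2^-1 by [lra]; split => //; case/andP: (sl_ge0 hx').
  have := sl_bounds hx1.
  rewrite (_ : mub ^+ 2 * b ^+ 2 * _ = (b * S1 (tau x)) ^+ 2); last by rewrite [RHS]exprMn E; ring.
  set y := b * S1 _ => /andP[lo hi]; have y0 : 0 <= y by rewrite mulr_ge0 ?ltW.
  apply/andP; split; last by rewrite -(@ler_pXn2r _ 2).
  (* [(1 - k) ^ 2 <= 1 - k], so the factor survives the square root. *)
  rewrite -(@ler_pXn2r _ 2)// ?nnegrE; last by apply: mulr_ge0 => //; lra.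
  by apply: le_trans lo; rewrite exprMn ler_wpM2r ?sqr_ge0//; nra.
have dtau (x : R) : 0 < x <= 2^-1 ->
    is_derive x 1 tau ((S1 (tau x))^-1 * (sl x / eps)).
  move=> hx; have dz : is_derive x 1 z (sl x / eps).
    have /is_derive_eq := derive_add (derive_mul (dQ x) (derive_cst eps^-1 x)) (derive_cst (- 1) x).
    by apply; ring.
  exact: derive_comp (dg _ (z0 _ hx)) dz.
(* Replaces continuity of [tau] at 0. As [sl <= 2], [Q x <= eps + 2 * x]; taking
   [x <= eps * S e / 2] keeps [z x <= S e], that is [tau x <= e]. *)
have start e : 0 < e -> exists x, [/\ 0 < x <= 2^-1, x <= e & tau x <= e].
  move=> e0; have Se : 0 < S e by apply: profile_gt0 m1 hS _ e0.
  pose x := Num.min (Num.min 2^-1 e) (eps * S e / 2).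
  have x0 : 0 < x by rewrite /x !lt_min e0 !divr_gt0 ?mulr_gt0//= invr_gt0; lra.
  have x2 : x <= 2^-1 by rewrite /x !ge_min lexx.
  have xe : x <= e by rewrite /x !ge_min lexx !orbT.
  have xS : x <= eps * S e / 2 by rewrite /x !ge_min lexx !orbT.
  have hx : 0 < x <= 2^-1 by lra.
  exists x; split => //; rewrite leNgt; apply/negP => lt.
  have := profile_lt m1 hS (ltW e0) lt; rewrite /tau Sg ?ltW ?z0// ltNge => /negP; apply.
  have Qx : Q x - eps <= 2 * x.
    have dl (t : R) : is_derive t 1 (fun t => 2 * t) 2.
      by have /is_derive_eq := derive_mul (derive_cst 2 t) (derive_id t); apply; ring.
    have := derive_cmp (ltW x0) (fun t _ => dQ t) (fun t _ => dl t).
    rewrite mulr0 subr0 Q0; apply => t /andP[t0 tx].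
    by have /andP[] : 0 <= sl t <= 2 by apply: sl_ge0; lra.
  by rewrite /z lerBlDr ler_pdivrMr//; lra.
have I_start x : 0 < x <= 2^-1 -> 0 <= I x <= 4 * x.
  move=> /andP[x0 x2]; apply/andP; split.
    by rewrite -I0; apply: (derive_le (ltW x0) (fun t _ => dI t)) => t _; apply: sqr_ge0.
  have dl (t : R) : is_derive t 1 (fun t => 4 * t) 4.
    by have /is_derive_eq := derive_mul (derive_cst 4 t) (derive_id t); apply; ring.
  have := derive_cmp (ltW x0) (fun t _ => dI t) (fun t _ => dl t).
  rewrite mulr0 !subr0 I0 subr0; apply => t /andP[t0 tx].
  by have /andP[] : 0 <= sl t <= 2 by [apply: sl_ge0; lra]; nra.
have dc c (x : R) : is_derive x 1 (fun t => c * t) c.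
  by have /is_derive_eq := derive_mul (derive_cst c x) (derive_id x); apply; ring.
have tau_slope x : 0 < x <= 2^-1 ->
    (1 - k) * (b / eps) <= (S1 (tau x))^-1 * (sl x / eps) <= b / eps.
  move=> hx; have /andP[lo hi] := slS x hx; have S1x := S1tau x hx.
  rewrite (_ : _^-1 * _ = sl x / S1 (tau x) / eps); last by ring.
  rewrite (mulrA (1 - k)) !ler_pM2r ?invr_gt0//.
  by rewrite ler_pdivlMr// ler_pdivrMr// -mulrA lo hi.
have tau_incr x : 0 < x <= 2^-1 -> (1 - k) * (b / eps) * (2^-1 - x) <=
    tau 2^-1 - tau x <= b / eps * (2^-1 - x).
  move=> /andP[x0 x2]; rewrite !mulrBr.
  have dt (t : R) : x <= t <= 2^-1 -> _ := fun h => dtau t ltac:(lra).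
  apply/andP; split.
    by apply: (derive_cmp x2 (fun t _ => dc _ t) dt) => t ht;
       have /andP[] := tau_slope t ltac:(lra).
  by apply: (derive_cmp x2 dt (fun t _ => dc _ t)) => t ht;
     have /andP[] := tau_slope t ltac:(lra).
(* Since [tau' = sl / (eps * S' tau)], the derivative of [b * eps * M tau] is [b * S' tau * sl];
   comparing it with [I' = sl ^ 2] is [slS] multiplied by [sl]. *)
have I_incr x : 0 < x <= 2^-1 -> (1 - k) * (b * eps) * (M (tau 2^-1) - M (tau x)) <=
    I 2^-1 - I x <= b * eps * (M (tau 2^-1) - M (tau x)).
  move=> /andP[x0 x2]; rewrite !mulrBr.
  have dMt c (t : R) : x <= t <= 2^-1 ->
      is_derive t 1 (fun u => c * M (tau u)) (c * (S1 (tau t) * (sl t / eps))).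
    move=> ht; have ht' : 0 < t <= 2^-1 by lra.
    have S1t := S1tau t ht'.
    have d := derive_comp (g := tau) (dM (tau t)) (dtau t ht').
    have /is_derive_eq := derive_mul (derive_cst c t) d; apply; rewrite -/S1.
    by field; rewrite !gt_eqF.
  have comp t : x < t < 2^-1 ->
      (1 - k) * (b * eps) * (S1 (tau t) * (sl t / eps)) <= sl t ^+ 2
        <= b * eps * (S1 (tau t) * (sl t / eps)).
    move=> ht; have /andP[lo hi] := slS t ltac:(lra).
    have /andP[s0 _] : 0 <= sl t <= 2 by apply: sl_ge0; lra.
    have -> : b * eps * (S1 (tau t) * (sl t / eps)) = b * S1 (tau t) * sl t.
      by field; rewrite gt_eqF.
    have -> : (1 - k) * (b * eps) * (S1 (tau t) * (sl t / eps)) =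
        (1 - k) * (b * S1 (tau t)) * sl t by field; rewrite gt_eqF.
    by rewrite expr2; apply/andP; split; apply: ler_wpM2r.
  apply/andP; split.
    by apply: (derive_cmp x2 (dMt _) (fun t _ => dI t)) => t /comp/andP[].
  by apply: (derive_cmp x2 (fun t _ => dI t) (dMt _)) => t /comp/andP[].
have bE : b / (2 * eps) = b / eps / 2 by field; rewrite gt_eqF.
have T0 := tau0 _ half.
exists (tau 2^-1) => //; split.
- by rewrite Stau// mulrC divfK// gt_eqF.
- have kb0 : 0 <= (1 - k) * (b / eps) by apply: mulr_ge0; [lra|exact: ltW].
  rewrite bE; apply/andP; split.
    apply: (le_of_linear_error kb0).
    move=> e /start[x [hx xe te]]; have /andP[lo _] := tau_incr x hx.
    have := tau0 x hx.
    have : (1 - k) * (b / eps) * x <= (1 - k) * (b / eps) * e.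
      exact: ler_wpM2l.
    by lra.
  apply: (@le_of_linear_error _ _ _ 1) => // e /start[x [hx xe te]].
  have /andP[_ hi] := tau_incr x hx; have /andP[x0 _] := hx.
  by have := mulr_gt0 be0 x0; lra.
- exact: slS half.
- have bee : 0 <= b * eps by exact/ltW/mulr_gt0.
  have kbe : 0 <= (1 - k) * (b * eps) by rewrite mulr_ge0//; lra.
  apply/andP; split.
    apply: (@le_of_linear_error _ _ _ ((1 - k) * (b * eps) * mub ^+ 2)).
      by rewrite mulr_ge0// sqr_ge0.
    move=> e e0; have [x [hx xe te]] := start e e0.
    have /andP[lo _] := I_incr x hx; have /andP[_ Mx] := profile_action_bounds (tau0 x hx).
    have Me : M (tau x) <= mub ^+ 2 * e.
      by apply: le_trans Mx _; apply: ler_wpM2l; rewrite ?sqr_ge0.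
    have := ler_wpM2l kbe Me; have /andP[i0 _] := I_start x hx.
    by lra.
  apply: (@le_of_linear_error _ _ _ 4) => // e e0; have [x [hx xe te]] := start e e0.
  have /andP[_ hi] := I_incr x hx; have /andP[Mx _] := profile_action_bounds (tau0 x hx).
  by have := mulr_ge0 bee Mx; have /andP[_ i0] := I_start x hx; lra.
Qed.

End Comparison.

(* [q1], [q2] stand for [T ^ (1 - m)] and [T ^ (- m)]. *)
Lemma amplitude_relations {R : realType} (u kappa eta C0 ce ck c4 c5 : R)
    (a b eps p e k T q1 q2 ST S1T MT V0 V1 sl I W1 N : R) :
  0 < u -> 0 <= C0 -> 0 <= ce -> 0 <= ck -> 0 <= c4 -> 0 <= c5 ->
  0 < eps -> 0 <= p <= 1 -> a = u * b -> 0 < a <= 8 ->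
  0 <= e <= ce * p -> 0 <= k <= ck * p -> k <= 1 ->
  0 <= q1 -> eps * q1 <= c4 * p -> q2 <= c5 * p ->
  (1 - k) * (b / (2 * eps)) <= T <= b / (2 * eps) ->
  `|ST - (u * T - kappa)| <= C0 * q1 -> 0 <= u - S1T <= C0 * q2 -> 0 <= S1T ->
  `|MT - (u ^+ 2 * T - u * kappa - eta)| <= C0 * q1 -> 0 <= MT <= u ^+ 2 * T ->
  sl = V0 - V1 -> 0 <= V1 <= e -> 0 <= V0 <= 2 ->
  (1 - k) * (b * S1T) <= sl <= b * S1T ->
  (1 - k) * (b * eps * MT) <= I <= b * eps * MT ->
  V0 / 2 <= 1 - eps * (1 + ST) <= V0 / 2 + e ->
  V0 ^+ 2 / 2 <= W1 - I <= (V0 + 2 * e) ^+ 2 / 2 ->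
  W1 <= N <= W1 + e ^+ 2 ->
  let cb := 8 / u in
  let c1 := ce + 8 * ck + cb * C0 * c5 in
  `|a - (1 + eps * (kappa - 1))| <= (ce + (4 * ck + C0 * c4) + c1) * p /\
  `|N - a * (a - eps * (kappa + eta / u))| <=
     (cb * C0 * c4 + 64 * ck + 5 * c1 + 4 * ce + 3 * ce ^+ 2) * p.
Proof.
move=> u0 C00 ce0 ck0 c40 c50 eps0 /andP[p0 p1] aE /andP[a0 a8] /andP[e0 ep]
  /andP[k0 kp] k1 q10 q1p q2p /andP[T1 T2] /[!ler_norml]/andP[ST1 ST2]
  /andP[S11 S12] S1T0 /andP[M1 M2] /andP[M3 M4] slE /andP[V10 V1e] /andP[V00 V02]
  /andP[sl1 sl2] /andP[I1 I2] /andP[R1 R2] /andP[W1l W1u] /andP[N1 N2] cb c1.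
have b0 : 0 < b by move: a0; rewrite aE pmulr_rgt0.
have bcb : b <= cb by rewrite /cb ler_pdivlMr// mulrC -aE.
have cb0 : 0 <= cb by apply: le_trans bcb; exact: ltW.
have uT : (1 - k) * (a / 2) <= eps * (u * T) <= a / 2.
  have ue : 0 <= eps * u by exact/ltW/mulr_gt0.
  have := ler_wpM2l ue T1; have := ler_wpM2l ue T2.
  have -> : eps * u * (b / (2 * eps)) = a / 2 by rewrite aE; field; rewrite gt_eqF.
  have -> : eps * u * ((1 - k) * (b / (2 * eps))) = (1 - k) * (a / 2).
    by rewrite aE; field; rewrite gt_eqF.
  by rewrite mulrA => -> ->.
clear T1 T2.
have ka : k * a <= 8 * ck * p by have := ler_pM k0 (ltW a0) kp a8; clear; lra.
have C0q1 : eps * (C0 * q1) <= C0 * c4 * p.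
  by have := ler_wpM2l C00 q1p; clear; lra.
have STa : `|eps * ST - (a / 2 - eps * kappa)| <= (4 * ck + C0 * c4) * p.
  have /andP[uT1 uT2] := uT.
  have := ler_wpM2l (ltW eps0) ST1; have := ler_wpM2l (ltW eps0) ST2.
  have := mulr_ge0 ck0 p0.
  clear -ST1 ST2 uT1 uT2 C0q1 ka ck0 p0; rewrite ler_norml => *.
  by apply/andP; split; lra.
clear ST1 ST2 C0q1.
have V0a : `|V0 - a| <= c1 * p.
  have bq : b * (u - S1T) <= cb * C0 * c5 * p.
    have -> : cb * C0 * c5 * p = cb * (C0 * (c5 * p)) by ring.
    apply: ler_pM => //; first exact: ltW.
    by apply: le_trans S12 _; exact: ler_wpM2l.
  have bS : b * S1T <= a.
    by rewrite aE mulrC; apply: ler_wpM2r; [exact: ltW|rewrite -subr_ge0].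
  have kbS : k * (b * S1T) <= 8 * ck * p.
    by apply: le_trans ka; apply: ler_wpM2l.
  have := mulr_ge0 ck0 p0; have := mulr_ge0 ce0 p0.
  have := mulr_ge0 (mulr_ge0 (mulr_ge0 cb0 C00) c50) p0.
  clear -bS bq kbS slE V10 V1e ep sl1 sl2 aE; rewrite /c1 ler_norml => *.
  by apply/andP; split; lra.
clear slE V10 V1e sl1 sl2 S11 S12 S1T0 q2p.
have c10 : 0 <= c1 * p by apply: le_trans V0a.
(* [Rw (1/2)] in two ways: [V0 / 2], nearly [a / 2], and [1 - eps * (1 + ST)], nearly
   [1 - eps - a / 2 + eps * kappa]. Solving for [a] gives the first relation. *)
split.
  have := mulr_ge0 ce0 p0.
  clear -STa V0a R1 R2 ep; move: STa V0a; rewrite !ler_norml => /andP[? ?] /andP[? ?] ?.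
  by apply/andP; split; lra.
clear STa R1 R2.
have be0 : 0 < b * eps by exact: mulr_gt0.
have bM : b * eps * (u ^+ 2 * T) <= a ^+ 2 / 2 /\
    a ^+ 2 / 2 - 32 * ck * p <= b * eps * (u ^+ 2 * T).
  have /andP[uT1 uT2] := uT.
  have -> : b * eps * (u ^+ 2 * T) = a * (eps * (u * T)) by rewrite aE; ring.
  have := ler_wpM2l (ltW a0) uT1; have := ler_wpM2l (ltW a0) uT2.
  have kaa : k * a * a <= 8 * ck * p * 8.
    by apply: ler_pM => //; [exact/mulr_ge0/ltW|exact: ltW].
  by clear -kaa; move=> *; split; lra.
have a2 : a ^+ 2 / 2 <= 32 by clear -a0 a8; nra.
have bMT : b * eps * MT <= 32.
  by have := ler_wpM2l (ltW be0) M4; clear -bM a2; case: bM => *; lra.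
have kbM : k * (b * eps * MT) <= 32 * ck * p.
  have bM0 : 0 <= b * eps * MT by apply: mulr_ge0 => //; exact: ltW.
  have := ler_pM k0 bM0 kp bMT; clear; lra.
have q1b : b * eps * (C0 * q1) <= cb * C0 * c4 * p.
  have -> : b * eps * (C0 * q1) = b * (C0 * (eps * q1)) by ring.
  have -> : cb * C0 * c4 * p = cb * (C0 * (c4 * p)) by ring.
  apply: ler_pM => //; first exact: ltW.
    by rewrite !mulr_ge0// ltW.
  exact: ler_wpM2l.
have aeta : a * (eps * (kappa + eta / u)) = b * eps * (u * kappa + eta).
  by rewrite aE; field; rewrite gt_eqF.
have IE : `|I - (a ^+ 2 / 2 - a * (eps * (kappa + eta / u)))| <=
    (cb * C0 * c4 + 64 * ck) * p.
  have := ler_wpM2l (ltW be0) M1; have := ler_wpM2l (ltW be0) M2.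
  rewrite aeta; case: bM; have := mulr_ge0 ck0 p0.
  clear -q1b kbM I1 I2; rewrite ler_norml => *; apply/andP; split; lra.
clear M1 M2 M3 M4 I1 I2 bM bMT kbM.
have ee : e ^+ 2 <= ce ^+ 2 * p.
  have := ler_pM e0 e0 ep ep; have := mulr_ge0 (mulr_ge0 ce0 ce0) p0.
  by clear -p0 p1; rewrite !expr2; nra.
have eV : e * V0 <= 2 * ce * p by have := ler_pM e0 V00 ep V02; clear; lra.
(* The 10 bounds [V0 + a], as [V0 <= 2] and [a <= 8]. *)
have V0sq : `|V0 ^+ 2 - a ^+ 2| <= 10 * c1 * p.
  rewrite subr_sqr normrM -mulrA mulrC.
  apply: ler_pM => //.
  by clear -a0 a8 V00 V02; rewrite ger0_norm; lra.
have := mulr_ge0 ce0 p0; have := sqr_ge0 e; have := mulr_ge0 e0 V00.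
clear -V0sq IE W1l W1u N1 N2 ee eV.
move: V0sq IE; rewrite !ler_norml => /andP[? ?] /andP[? ?] *.
by apply/andP; split; lra.
Qed.

(** * Matching the wave with the profile, uniformly in the wave *)

Section WaveAsymptotics.
Context {R : realType}.

(** Makes the error of [energy_bounds] relative. With [y = gap / eps >= 1], [gap <= 1] gives
    [gap - eps <= 1 - 1 / y], and [m > 1] gives [1 - 1 / y <= 1 - y ^ -m], the factor in [E]; the
    ratio of the prefactors is of order [eps ^ m] because [b ^ 2 * eps ^ m = 1 / sigma]. *)
Lemma gap_energy_bounds (m : R) V Rw sigma N F G W x :
  wave_primitives m V Rw sigma N F G W -> 1 - Rw 0 <= 8^-1 -> 0 <= x <= 2^-1 ->
  let eps := 1 - Rw 0 in
  let b := Num.sqrt (eps `^ (- m) / sigma) in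
  let E := mu_bar m ^+ 2 * b ^+ 2 * (1 - (gap Rw x / eps) `^ (- m)) in
  ((1 - (4 / (m + 1) + 4 * far_bound m) / mu_bar m ^+ 2 * eps `^ m) * E
    <= gap_slope V x ^+ 2 <= E : Prop).
Proof.
move=> hw e8 hx eps b E; have := energy_bounds hw e8 hx.
rewrite -/eps; set K := _ + 4 * far_bound m => /andP[lo hi].
have m1 := wp_m hw; have s0 := wp_sigma hw; have eps0 : 0 < eps := eps_gt0 hw.
have mub0 := mu_bar_gt0 m1; have mub2 : 0 < mu_bar m ^+ 2 by apply: exprn_gt0.
have Q0 := gap_gt0 hw x; have Q1 := gap_le1 hw x.
have b2 : b ^+ 2 = eps `^ (- m) / sigma.
  by rewrite sqr_sqrtr// divr_ge0 ?powR_ge0 ?ltW.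
have epsm : eps `^ m * eps `^ (- m) = 1.
  by rewrite powRN mulfV// gt_eqF// powR_gt0.
have EE : E = 4 / (m * (m + 1)) / sigma * (eps `^ (- m) - gap Rw x `^ (- m)).
  have yE : (gap Rw x / eps) `^ (- m) = gap Rw x `^ (- m) * eps `^ m.
    rewrite powRM ?invr_ge0 ?(ltW eps0) ?(ltW Q0)//.
    by rewrite -[eps^-1](powR_inv1 (ltW eps0)) -powRrM mulN1r opprK.
  rewrite /E (mu_bar_sqr m1) b2 yE.
  transitivity (4 / (m * (m + 1)) / sigma *
      (eps `^ (- m) - gap Rw x `^ (- m) * (eps `^ m * eps `^ (- m)))); first by ring.
  by rewrite epsm mulr1.
rewrite EE; apply/andP; split => //; apply: le_trans lo.
rewrite -EE mulrBl mul1r lerB//.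
have -> : K / mu_bar m ^+ 2 * eps `^ m * E =
    K / sigma * (1 - (gap Rw x / eps) `^ (- m)) * (eps `^ m * eps `^ (- m)).
  by rewrite /E b2; field; rewrite !gt_eqF.
have K0 : 0 <= K.
  have := far_bound_gt0 m; have : 0 < 4 / (m + 1) by apply: divr_gt0; lra.
  by rewrite /K; lra.
rewrite epsm mulr1; apply: ler_wpM2l; first by rewrite divr_ge0// ltW.
have epsQ : eps <= gap Rw x.
  by rewrite /gap /eps lerB// (Rw_le0 hw).
have y1 : 1 <= gap Rw x / eps by rewrite ler_pdivlMr ?mul1r.
have ym : (gap Rw x / eps) `^ (- m) <= (gap Rw x / eps) `^ (- 1).
  by apply: ler_powR => //; lra.
apply: (@le_trans _ _ (1 - (gap Rw x / eps) `^ (- 1))); last by lra.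
rewrite powR_inv1 ?invf_div; last by lra.
have -> : 1 - eps / gap Rw x = (gap Rw x - eps) / gap Rw x by field; rewrite gt_eqF.
by rewrite ler_pdivlMr//; nra.
Qed.

Lemma powR_inv_le (c T p : R) : 0 <= p -> 0 < c -> c^-1 <= T -> T `^ (- p) <= c `^ p.
Proof.
move=> p0 c0 cT; apply: le_trans (powRN_le p0 _ cT) _; first by rewrite invr_gt0.
by rewrite -[c^-1](powR_inv1 (ltW c0)) -powRrM mulN1r opprK.
Qed.

(** The source of the order [eps ^ m] in the profile errors: [T] is at least of order [1 / eps], and
    the error [T ^ (1 - m)] of [S] and [M] is met with one more factor [eps]. *)
Lemma large_time_powers (m u eps T : R) : 1 < m -> 0 < u -> 0 < eps ->
  (16 * u * eps)^-1 <= T -> 16 * u * eps <= 1 ->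
  [/\ 1 <= T, T `^ (1 - m) <= 1,
      eps * T `^ (1 - m) <= (16 * u) `^ (m - 1) * eps `^ m &
      T `^ (- m) <= (16 * u) `^ m * eps `^ m].
Proof.
move=> m1 u0 eps0 Tlo ue1.
have u16 : 0 <= 16 * u by apply/ltW/mulr_gt0.
have ue0 : 0 < 16 * u * eps by rewrite !mulr_gt0.
have T1 : 1 <= T by apply: le_trans Tlo; rewrite invf_ge1.
split => //.
- by rewrite -[leRHS](powRr0 T); apply: ler_powR => //; lra.
- have : T `^ (1 - m) <= (16 * u * eps) `^ (m - 1).
    by rewrite -(opprB m 1); apply: powR_inv_le => //; lra.
  rewrite powRM ?(ltW eps0)// => /(ler_wpM2l (ltW eps0)).
  by rewrite mulrCA mulr_powRB1 ?(ltW eps0)//; lra.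
- by rewrite -powRM ?(ltW eps0)//; apply: powR_inv_le => //; lra.
Qed.

(** The 16 collects [1 - k >= 1/2], [u * b >= 1/4] and the 2 of [b / (2 * eps)]. *)
Lemma time_ge (u eps b k T : R) : 0 < u -> 0 < eps -> k <= 2^-1 -> 4^-1 <= u * b ->
  (1 - k) * (b / (2 * eps)) <= T -> (16 * u * eps)^-1 <= T.
Proof.
move=> u0 eps0 k12 a4; apply: le_trans.
have -> : b / (2 * eps) = u * b * 8 * (16 * u * eps)^-1.
  by field; rewrite !gt_eqF.
have Y0 : 0 <= (16 * u * eps)^-1 by rewrite invr_ge0 !mulr_ge0 ?(ltW u0) ?(ltW eps0).
have := @ler_pM R 2^-1 (1 - k) 2 (u * b * 8) ltac:(lra) ltac:(lra) ltac:(lra) ltac:(lra).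
by move/(ler_wpM2r Y0); lra.
Qed.

(** The gap never exceeds 1, so the profile cannot have run too long: [eps * ST <= 1] gives
    [eps * u * T <= 2], while [T] is at least half of [b / (2 * eps)]. *)
Lemma amplitude_le8 (u eps b k T ST q1 kappa C0 : R) : 0 < u -> 0 < eps -> 0 < b ->
  k <= 2^-1 -> 0 <= C0 -> q1 <= 1 ->
  eps <= (`|kappa| + C0 + 1)^-1 -> (1 - k) * (b / (2 * eps)) <= T ->
  `|ST - (u * T - kappa)| <= C0 * q1 -> eps * (1 + ST) <= 1 -> u * b <= 8.
Proof.
move=> u0 eps0 b0 k12 C00 q11 eD Tb STas Q1.
have D0 : 0 < `|kappa| + C0 + 1 by have := normr_ge0 kappa; lra.
have eD1 : eps * (`|kappa| + C0 + 1) <= 1 by move: eD; rewrite -[_^-1]mul1r ler_pdivlMr.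
have uT : eps * (u * T) <= 2.
  have : u * T <= ST + `|kappa| + C0.
    have := ler_norm kappa; have := ler_wpM2l C00 q11.
    by move: STas; rewrite ler_norml => /andP[? ?] *; lra.
  by move/(ler_wpM2l (ltW eps0)); lra.
have := ler_wpM2l (ltW (mulr_gt0 eps0 u0)) Tb.
have -> : eps * u * ((1 - k) * (b / (2 * eps))) = (1 - k) * (u * b / 2).
  by field; rewrite gt_eqF.
have ub0 := mulr_gt0 u0 b0 => h.
have : 2^-1 * (u * b / 2) <= (1 - k) * (u * b / 2) by apply: ler_wpM2r; lra.
by lra.
Qed.

(** The order of the bounds matters: [a >= 1/4] without [sigma], then [T] large, then [a <= 8], and
    only then [1 / sigma = b ^ 2 * eps ^ m = O(eps ^ m)], which makes all error terms small. [C] and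
    [e0] depend on [m] and [S] only. *)
Lemma wave_asymptotics (m : R) (S : R -> R) : 1 < m -> limit_profile m S ->
  exists C e0, 0 < e0 /\ forall V Rw sigma N F G W,
  wave_primitives m V Rw sigma N F G W ->
  let eps := 1 - Rw 0 in
  let a := mu_bar m * Num.sqrt (eps `^ (- m) / sigma) in
  eps <= e0 ->
  [/\ 4^-1 <= a,
      `|a - (1 + eps * (kappa_bar S - 1))| <= C * eps `^ m &
      `|N - a * (a - eps * (kappa_bar S + eta_bar S / mu_bar m))| <= C * eps `^ m].
Proof.
move=> m1 hS; have [C0 [M [C00 Sas S1as [M0 dM] Mas]]] := profile_asymptotics m1 hS.
set u := mu_bar m; set kappa := kappa_bar S; set eta := eta_bar S.
have u0 : 0 < u := mu_bar_gt0 m1.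
pose L : R := far_bound m; have L0 : 0 < L := far_bound_gt0 m.
pose K := 4 / (m + 1) + 4 * L.
have K0 : 0 < K.
  have : 0 < 4 / (m + 1) by apply: divr_gt0; lra.
  by rewrite /K; lra.
pose ck := K / u ^+ 2; have ck0 : 0 < ck by rewrite divr_gt0 ?exprn_gt0.
pose cb := 8 / u; have cb0 : 0 < cb by apply: divr_gt0.
pose ce := L * cb ^+ 2; have ce0 : 0 <= ce by rewrite mulr_ge0 ?sqr_ge0 ?ltW.
pose c4 := (16 * u) `^ (m - 1); pose c5 := (16 * u) `^ m.
pose c1 := ce + 8 * ck + cb * C0 * c5.
pose CA := ce + (4 * ck + C0 * c4) + c1.
pose CB := cb * C0 * c4 + 64 * ck + 5 * c1 + 4 * ce + 3 * ce ^+ 2.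
(* In turn: 1/8 for [Rw <= 3/4] beyond 1/2, [(16 * u)^-1] for [T >= 1], [(2 * ck)^-1] for
   [k <= 1/2], and the last for [amplitude_le8]. *)
pose e0 := Num.min (Num.min 8^-1 (16 * u)^-1) (Num.min (2 * ck)^-1 (`|kappa| + C0 + 1)^-1).
have D0 : 0 < `|kappa| + C0 + 1 by have := normr_ge0 kappa; lra.
exists (Num.max CA CB), e0; split.
  by rewrite /e0 !lt_min !invr_gt0 D0; have := mulr_gt0 (ltr0n R 16 : 0 < 16 :> R) u0; lra.
move=> V Rw sigma N F G W hw eps a.
rewrite /e0 !le_min => /andP[/andP[e8 eu] /andP[eck eD]].
have eps0 : 0 < eps := eps_gt0 hw; have s0 := wp_sigma hw.
pose b := Num.sqrt (eps `^ (- m) / sigma); pose p := eps `^ m.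
have p0 : 0 < p by apply: powR_gt0.
have peps : p <= eps by apply: ge1r_powR; lra.
have p01 : 0 <= p <= 1 by lra.
pose k := ck * p.
have k12 : k <= 2^-1.
  have ck2 : 0 < 2 * ck by lra.
  have : p <= (2 * ck)^-1 by lra.
  by rewrite -[_^-1]mul1r ler_pdivlMr// /k; lra.
have k0 : 0 <= k by apply: mulr_ge0; exact: ltW.
have k1 : k <= 1 by lra.
have k01 : 0 <= k <= 1 by rewrite k0.
have b0 : 0 < b by rewrite sqrtr_gt0 divr_gt0// powR_gt0.
have b2 : b ^+ 2 * p = sigma^-1.
  rewrite sqr_sqrtr; last by rewrite divr_ge0 ?powR_ge0 ?ltW.
  rewrite mulrAC -powRD; last by rewrite (gt_eqF eps0) implybT.
  by rewrite addNr powRr0 mul1r.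
have cR : continuous (fun x => gap_slope V x ^+ 2).
  by move=> x; exact: is_derive_continuous (derive_sqr (derive_slope hw x)).
have [I [I0 dI]] := continuous_primitive cR.
have slb x : 0 <= x <= 2^-1 -> 0 <= gap_slope V x <= 2.
  by move=> hx; rewrite (slope_ge0 hw)//= (slope_le2 hw).
have [T T0 [QT Tb slT IT]] := @profile_time_bounds _ m S M m1 hS M0 dM (gap Rw) (gap_slope V) I
  eps b k eps0 b0 k01 erefl (derive_gap hw) (gap_gt_eps hw e8) slb I0 dI
  (fun x hx => gap_energy_bounds hw e8 hx).
have aE : a = u * b by [].
have v0 := V_ge0 hw 0; have v2 := V0_le2 hw.
have slE := slope_half V.
have S1T1 := profile1_le_mu_bar m1 hS T0; have S1T0 := profile1_ge0 m1 hS T0.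
(* [V 0 - V 1 >= 1 - eps - (4 * eps + 1/8) >= 1/4], and this slope is at most
   [b * S' T <= b * u = a]. *)
have a14 : 4^-1 <= a.
  have := V0_ge hw; have := V1_le_eps hw; rewrite -/eps.
  have /andP[_ slT2] := slT; have := ler_wpM2l (ltW b0) S1T1.
  by rewrite -/u aE => *; lra.
have /andP[Tb1 _] := Tb.
have ue1 : 16 * u * eps <= 1.
  have u16 : 0 < 16 * u by apply: mulr_gt0.
  by move: eu; rewrite -[_^-1]mul1r ler_pdivlMr// mulrC.
have [T1 q1le1 q1p q2p] := large_time_powers m1 u0 eps0 (time_ge u0 eps0 k12 a14 Tb1) ue1.
have q10 := powR_ge0 T (1 - m); have ST := Sas T T1.
have a8 : a <= 8.
  by have := gap_le1 hw 2^-1; rewrite QT; apply: amplitude_le8 eD Tb1 ST.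
have a08 : 0 < a <= 8 by rewrite a8 andbT; apply: mulr_gt0.
have Ls0 := far_ratio_gt0 hw.
(* Here [a <= 8] pays off: [1 / sigma = b ^ 2 * p] with [b <= 8 / u]. *)
have ep : L / sigma <= ce * p.
  rewrite -b2 /ce -mulrA; apply: ler_wpM2l; first exact: ltW.
  apply: ler_wpM2r; first exact: ltW.
  by rewrite ler_pXn2r ?nnegrE ?(ltW b0) ?(ltW cb0)// /cb ler_pdivlMr// mulrC -aE.
have Le : 0 <= L / sigma <= ce * p by rewrite (ltW Ls0).
have kck : 0 <= k <= ck * p by rewrite k0 lexx.
have MT0 := profile_action_bounds m1 hS M0 dM T0.
have RT := Rw_half_V0 hw e8.
have RE : Rw 2^-1 = 1 - eps * (1 + S T) by rewrite -QT /gap; ring.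
have WN := norm_le_W1 hw e8; have NW := wp_leN hw (ler01 : 0 <= 1 :> R).
have WI := W1_slope hw e8 I0 dI.
have v1 := V1_le hw e8; have v10 := V_ge0 hw 1.
have [] := @amplitude_relations R u kappa eta C0 ce ck c4 c5 a b eps p (L / sigma) k T
  (T `^ (1 - m)) (T `^ (- m)) (S T) ((S^`())%classic T) (M T) (V 0) (V 1) (gap_slope V 2^-1)
  (I 2^-1) (2 * W 1) N u0 C00 ce0 (ltW ck0) (powR_ge0 _ _) (powR_ge0 _ _) eps0
  p01 aE a08 Le kck k1 q10 q1p q2p Tb ST.
- by rewrite subr_ge0 S1T1 S1as.
- exact: S1T0.
- exact: Mas.
- exact: MT0.
- exact: slE.
- by rewrite v10.
- by rewrite v0.
- exact: slT.
- exact: IT.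
- by rewrite -RE.
- exact: WI.
- by rewrite NW.
move=> A1 A2; split => //.
- by apply: le_trans A1 _; apply: ler_wpM2r; rewrite ?powR_ge0// le_max lexx.
- by apply: le_trans A2 _; apply: ler_wpM2r; rewrite ?powR_ge0// le_max lexx orbT.
Qed.

End WaveAsymptotics.

(** * Elementary expansions of inverses and square roots *)

Section Expansions.
Context {R : realType}.
Implicit Types (kappa q e a p C d t : R).

Let D kappa q : R := `|kappa| + `|q| + 2.

Lemma small_parameters kappa q e : 0 < e -> e * D kappa q <= 4^-1 ->
  [/\ `|e * (kappa - 1)| <= 4^-1, `|e * (kappa + q)| <= 4^-1,
      3 / 4 <= 1 + e * (kappa - 1) <= 5 / 4 & 3 / 4 <= 1 - e * (1 + q) <= 5 / 4].
Proof.
rewrite /D => e0 eD.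
have b y : `|y| <= `|kappa| + `|q| + 2 -> `|e * y| <= 4^-1.
  move=> yD; rewrite normrM (gtr0_norm e0); apply: le_trans eD.
  by rewrite ler_pM2l.
have k0 := normr_ge0 kappa; have q0 := normr_ge0 q.
have b1 : `|e * (kappa - 1)| <= 4^-1.
  by apply: b; apply: le_trans (ler_normB _ _) _; rewrite normr1; lra.
have b2 : `|e * (kappa + q)| <= 4^-1.
  by apply: b; apply: le_trans (ler_normD _ _) _; lra.
have b3 : `|e * (1 + q)| <= 4^-1.
  by apply: b; apply: le_trans (ler_normD _ _) _; rewrite normr1; lra.
split => //.
  by move: b1; rewrite ler_norml; lra.
by move: b3; rewrite ler_norml; lra.
Qed.

Lemma inv_close a A C p : 4^-1 <= a -> 3 / 4 <= A -> `|a - A| <= C * p ->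
  `|a^-1 - A^-1| <= 8 * (C * p).
Proof.
move=> a4 A4 aA.
have -> : a^-1 - A^-1 = (A - a) * (a * A)^-1 by field; rewrite !gt_eqF//; lra.
rewrite normrM distrC mulrC; apply: ler_pM => //.
by rewrite ger0_norm ?invr_ge0; [rewrite -[8]invrK lef_pV2 ?posrE; nra|nra].
Qed.

Lemma inv_expansion t : `|t| <= 4^-1 -> `|(1 + t)^-1 - (1 - t)| <= 2 * t ^+ 2.
Proof.
rewrite ler_norml => /andP[t1 t2].
have -> : (1 + t)^-1 - (1 - t) = t ^+ 2 * (1 + t)^-1 by field; rewrite gt_eqF//; lra.
rewrite mulrC normrM (ger0_norm (sqr_ge0 t)); apply: ler_wpM2r; first exact: sqr_ge0.
rewrite ger0_norm ?invr_ge0; last by lra.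
by rewrite -[2]invrK lef_pV2 ?posrE; lra.
Qed.

(** Passes through [(1 + t)^-1]: 48 is 8 times 6, with 6 bounding the sum of the two inverses, and 8
    covers [2 * (13 / 4) + 1]. *)
Lemma inv_sqr_expansion t a C p : `|t| <= 4^-1 -> 4^-1 <= a ->
  `|a - (1 + t)| <= C * p ->
  `|(a ^+ 2)^-1 - (1 - 2 * t)| <= 48 * (C * p) + 8 * t ^+ 2.
Proof.
move=> t4 a4 at1; have := inv_expansion t4; have := inv_close a4 _ at1.
move: t4; rewrite ler_norml => /andP[t1 t2] H; have := H ltac:(lra).
set x := a^-1; set y := (1 + t)^-1 => xy yt; rewrite -exprVn -/x.
have x4 : 0 <= x <= 4.
  rewrite invr_ge0; apply/andP; split; first by lra.
  by rewrite -[4]invrK lef_pV2 ?posrE; lra.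
have y4 : 0 <= y <= 2.
  rewrite invr_ge0; apply/andP; split; first by lra.
  by rewrite -[2]invrK lef_pV2 ?posrE; lra.
have t20 := sqr_ge0 t; have Cp0 : 0 <= C * p by apply: le_trans at1.
have xy2 : `|x ^+ 2 - y ^+ 2| <= 8 * (C * p) * 6.
  rewrite subr_sqr normrM; apply: ler_pM => //.
  by rewrite ger0_norm; lra.
have y2 : `|y ^+ 2 - (1 - t) ^+ 2| <= 2 * t ^+ 2 * (13 / 4).
  rewrite subr_sqr normrM; apply: ler_pM => //.
  by rewrite ger0_norm; lra.
have := ler_normD (x ^+ 2 - y ^+ 2) (y ^+ 2 - (1 - t) ^+ 2 + t ^+ 2).
have := ler_normD (y ^+ 2 - (1 - t) ^+ 2) (t ^+ 2); rewrite (ger0_norm t20).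
by rewrite (_ : _ + (_ + t ^+ 2) = x ^+ 2 - (1 - 2 * t)); [lra|ring].
Qed.

(** With [A = 1 + e * (kappa - 1)], the second factor under the root is [A - e * (kappa + q)], so
    the root squared is the norm relation with [a] replaced by [A]. Dividing the difference of
    squares by [1 - d + s >= 3/4] turns 6 into 8. *)
Lemma norm_expansion kappa q e a p C d : 0 < e -> e * D kappa q <= 4^-1 ->
  0 <= d <= 1 -> C * p <= 1 -> `|a - (1 + e * (kappa - 1))| <= C * p ->
  `|(1 - d) ^+ 2 - a * (a - e * (kappa + q))| <= C * p ->
  `|d - (1 - Num.sqrt ((1 + e * (kappa - 1)) * (1 - e * (1 + q))))| <= 8 * (C * p).
Proof.
move=> e0 eD d01 Cp1 aA NA; have [_ + hA hB] := small_parameters e0 eD.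
set A := 1 + _ in aA hA *; set B := 1 - e * (1 + q) in hB *.
set x := e * (kappa + q) in NA *; rewrite ler_norml => hx.
have BE : B = A - x by rewrite /A /B /x; ring.
have Cp0 : 0 <= C * p by apply: le_trans aA.
set s := Num.sqrt _.
have AB : 9 / 16 <= A * B by nra.
have s2 : s ^+ 2 = A * B by rewrite sqr_sqrtr//; lra.
have s0 : 0 <= s by apply: sqrtr_ge0.
have s34 : 3 / 4 <= s by rewrite -(@ler_pXn2r _ 2) ?nnegrE// ?s2; lra.
have NAB : `|(1 - d) ^+ 2 - s ^+ 2| <= 6 * (C * p).
  rewrite s2 BE.
  have -> : (1 - d) ^+ 2 - A * (A - x) =
      ((1 - d) ^+ 2 - a * (a - x)) + (a - A) * (a + A - x) by ring.
  apply: le_trans (ler_normD _ _) _; rewrite normrM.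
  have : `|a + A - x| <= 5.
    by move: aA; rewrite !ler_norml => /andP[? ?]; apply/andP; split; lra.
  move=> h5; have := ler_pM (normr_ge0 _) (normr_ge0 _) aA h5; lra.
move: NAB; rewrite subr_sqr normrM (_ : d - (1 - s) = - (1 - d - s)); last by ring.
rewrite normrN (ger0_norm (_ : 0 <= 1 - d + s)); last by lra.
have := normr_ge0 (1 - d - s); nra.
Qed.

(** Compares squares instead of differentiating the root: [P ^ 2] agrees with the radicand exactly
    through order [e ^ 2], so [(s - P) * (s + P)] is a multiple of [e ^ 3], and [s + P >= 1/2]. *)
Lemma sqrt_expansion kappa q e : 0 < e -> e * D kappa q <= 4^-1 ->
  `|Num.sqrt ((1 + e * (kappa - 1)) * (1 - e * (1 + q))) -
    (1 - ((2 - kappa + q) / 2 * e + (kappa + q) ^+ 2 / 8 * e ^+ 2))|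
  <= D kappa q ^+ 3 * e ^+ 3.
Proof.
move=> e0 eD; have [_ hx hA hB] := small_parameters e0 eD.
set s := Num.sqrt _; set c1 := (2 - kappa + q) / 2; set c2 := (kappa + q) ^+ 2 / 8.
have s2 : s ^+ 2 = (1 + e * (kappa - 1)) * (1 - e * (1 + q)) by rewrite sqr_sqrtr//; nra.
have s0 : 0 <= s by apply: sqrtr_ge0.
have k0 := normr_ge0 kappa; have q0 := normr_ge0 q.
have D2 : 2 <= D kappa q by rewrite /D; lra.
have D0 : 0 <= D kappa q by lra.
have c1D : `|c1| <= D kappa q.
  rewrite /c1 /D; have := ler_norm kappa; have := ler_norm (- kappa).
  have := ler_norm q; have := ler_norm (- q); rewrite !normrN ler_norml => *.
  by apply/andP; split; lra.
have kqD : `|kappa + q| <= D kappa q by apply: le_trans (ler_normD _ _) _; rewrite /D; lra.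
have c20 : 0 <= c2 by rewrite divr_ge0 ?sqr_ge0.
have c2D : c2 <= D kappa q ^+ 2 / 8.
  by rewrite ler_pM2r ?invr_gt0// -real_normK ?num_real// ler_pXn2r ?nnegrE.
have ec1 : `|c1 * e| <= 4^-1.
  by rewrite normrM (gtr0_norm e0) mulrC; apply: le_trans eD; rewrite ler_pM2l.
have ec2 : c2 * e ^+ 2 <= 128^-1.
  have : c2 * e ^+ 2 <= D kappa q ^+ 2 / 8 * e ^+ 2 by rewrite ler_wpM2r ?sqr_ge0.
  have : 0 <= e * D kappa q by rewrite mulr_ge0// ltW.
  by nra.
set P := 1 - (c1 * e + c2 * e ^+ 2).
have P12 : 1 / 2 <= P by move: ec1; rewrite ler_norml /P => /andP[_ ?]; lra.
have PE : (s - P) * (s + P) = - (e ^+ 3 * (2 * c1 * c2 + c2 * (c2 * e))).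
  by rewrite -subr_sqr s2 /P /c1 /c2; field.
have c2e : c2 * e <= D kappa q.
  have : c2 * e <= D kappa q ^+ 2 / 8 * e by apply: ler_wpM2r => //; exact: ltW.
  by nra.
have err : `|2 * c1 * c2 + c2 * (c2 * e)| <= 2^-1 * D kappa q ^+ 3.
  have ce0 : 0 <= c2 * e by apply: mulr_ge0 => //; exact: ltW.
  apply: le_trans (ler_normD _ _) _; rewrite (ger0_norm (mulr_ge0 c20 ce0)).
  rewrite (normrM (2 * c1)) (normrM 2) (ger0_norm c20) (ger0_norm (_ : 0 <= 2))//.
  have h1 := ler_pM (normr_ge0 c1) c20 c1D c2D.
  have h2 := ler_pM c20 ce0 c2D c2e.
  have -> : D kappa q ^+ 3 = D kappa q * D kappa q ^+ 2 by rewrite exprS.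
  by have := mulr_ge0 D0 (sqr_ge0 (D kappa q)); lra.
have e30 : 0 < e ^+ 3 by apply: exprn_gt0.
have /(congr1 Num.norm) := PE; rewrite normrN (normrM (s - P)) (normrM (e ^+ 3)) (gtr0_norm e30) => E.
have sP : 1 / 2 <= `|s + P| by rewrite ger0_norm; lra.
have := ler_wpM2l (ltW e30) err; rewrite -E => h.
have := ler_wpM2l (normr_ge0 (s - P)) sP; lra.
Qed.

Lemma mu_sigma_of_amplitude (m u e sigma : R) : 0 < u -> 0 < e -> 0 < sigma ->
  let a := u * Num.sqrt (e `^ (- m) / sigma) in
  Num.sqrt (sigma * e `^ (m + 2)) = u * e * a^-1 /\
  sigma = u ^+ 2 * e `^ (- m) * (a ^+ 2)^-1.
Proof.
move=> u0 e0 s0 a; have p0 : 0 < e `^ (- m) by apply: powR_gt0.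
have b0 : 0 < Num.sqrt (e `^ (- m) / sigma) by rewrite sqrtr_gt0 divr_gt0.
have b2 : Num.sqrt (e `^ (- m) / sigma) ^+ 2 = e `^ (- m) / sigma.
  by rewrite sqr_sqrtr// divr_ge0// ltW.
split; last by rewrite /a exprMn b2; field; rewrite !gt_eqF.
have -> : u * e * a^-1 = e / Num.sqrt (e `^ (- m) / sigma).
  by rewrite /a; field; rewrite !gt_eqF.
apply/eqP; rewrite eq_sym -subr_eq0; apply/eqP.
have : (e / Num.sqrt (e `^ (- m) / sigma)) ^+ 2 = sigma * e `^ (m + 2).
  rewrite expr_div_n b2 powRD; last by rewrite (gt_eqF e0) implybT.
  rewrite (_ : e `^ 2 = e ^+ 2); last by rewrite -powR_mulrn// ltW.
  by rewrite powRN; field; rewrite !gt_eqF// powR_gt0.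
by move=> <-; rewrite sqrtr_sqr ger0_norm ?subrr// divr_ge0 ?ltW.
Qed.

End Expansions.

(** * Landau symbols and the limit along the family *)

Section LandauBounds.
Context {R : realType} (F : filter_on R).
Implicit Types f g e : R -> R.

Lemma bigO_of_bound f g e K :
  (\forall x \near F, `|f x - g x| <= K * `|e x|) -> f = g +O_F e.
Proof.
move=> H; apply/eqaddOP; near=> k; near=> x.
apply: (@le_trans _ _ (K * `|e x|)); first by near: x; exact: H.
by apply: ler_wpM2r => //; near: k; apply: nbhs_pinfty_ge; rewrite num_real.
Unshelve. all: by end_near. Qed.

Lemma littleo_of_bound f g e :
  (forall k, 0 < k -> \forall x \near F, `|f x - g x| <= k * `|e x|) -> f = g +o_F e.
Proof. by move=> H; apply/eqaddoP => k k0; near=> x; near: x; exact: H.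
Unshelve. all: by end_near. Qed.

End LandauBounds.

Section HighEnergyFamily.
Context {R : realType} (m : R) (V Rw : R -> R -> R) (sigma : R -> R).
Context (m1 : 1 < m) (hfam : high_energy_family m V Rw sigma).

Lemma family_primitives d : 0 < d < 1 -> exists F G W,
  wave_primitives m (V d) (Rw d) (sigma d) ((1 - d) ^+ 2) F G W.
Proof.
move=> hd; have [_ V1 V2 V3 V4] := hef_V hfam hd; have [_ R1 R2 R3 R4] := hef_R hfam hd.
exact: wave_primitives_exist m1 hd (hef_wave hfam hd) _ _ (hef_norm hfam hd).
Qed.

Lemma near_index : \forall d \near (0 : R)^'+, 0 < d < 1.
Proof.
near=> d; apply/andP; split; near: d; first exact: nbhs_right_gt.
exact: nbhs_right_lt.
Unshelve. all: by end_near. Qed.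

(** Otherwise [eps > e] would give [p <= eps ^ -(m + 2) <= e ^ -(m + 2)], against [p -> +oo]. *)
Lemma family_eps_small e : 0 < e -> \forall d \near 0^'+, 0 < eps_of Rw d <= e.
Proof.
move=> e0; have /cvgeyPgt/(_ (e `^ (- (m + 2)))) := hef_energy hfam.
move=> energy; near=> d.
have hd : 0 < d < 1 by near: d; exact: near_index.
have [F [G [W hw]]] := family_primitives hd.
have eps0 : 0 < eps_of Rw d := eps_gt0 hw; rewrite eps0/= leNgt; apply/negP => lt.
have : ((e `^ (- (m + 2)))%:E < (eps_of Rw d `^ (- (m + 2)))%:E)%E.
  by apply: lt_le_trans (potential_energy_le hw); near: d; exact: energy.
rewrite lte_fin ltNge => /negP; apply; apply: powRN_le => //; last exact: ltW.
by have m1' := m1; lra.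
Unshelve. all: by end_near. Qed.

Lemma family_eps_powR_small q k : 0 < q -> 0 < k ->
  \forall d \near 0^'+, eps_of Rw d `^ q <= k.
Proof.
move=> q0 k0; near=> d.
have /andP[e0 ek] : 0 < eps_of Rw d <= k `^ q^-1.
  by near: d; apply: family_eps_small; exact: powR_gt0.
have : eps_of Rw d `^ q <= (k `^ q^-1) `^ q.
  by apply: ge0_ler_powR => //; rewrite ?nnegrE ?powR_ge0// ltW.
by rewrite -powRrM mulVf ?gt_eqF// powRr1// ltW.
Unshelve. all: by end_near. Qed.

End HighEnergyFamily.

Theorem corollary13 (R : realType) (m : R) (hm : 1 < m)
    (V Rw : R -> R -> R) (sigma : R -> R)
    (hfam : high_energy_family m V Rw sigma)
    (S : R -> R) (hS : limit_profile m S) :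
  let eps := eps_of Rw in
  let mu := mu_of m Rw sigma in
  let mub := mu_bar m in
  let kappa := kappa_bar S in
  let eta := eta_bar S in
  [/\ mu = (fun d => mub * eps d / (1 + eps d * (kappa - 1)))
           +O_ (0^'+) (fun d => eps d `^ (m + 1)),
      (fun d => d) =
        (fun d => 1 - Num.sqrt ((1 + eps d * (kappa - 1)) *
                                (1 - eps d * (1 + eta / mub))))
        +O_ (0^'+) (fun d => eps d `^ m),
      mu = (fun d => mub * eps d + mub * (1 - kappa) * eps d ^+ 2)
           +o_ (0^'+) (fun d => eps d ^+ 2),
      sigma = (fun d => mub ^+ 2 * eps d `^ (- m)
                        + 2 * mub ^+ 2 * (1 - kappa) * eps d `^ (- m + 1))
              +o_ (0^'+) (fun d => eps d `^ (- m + 1))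
    & 2 < m ->
      (fun d => d) =
        (fun d => (2 * mub - mub * kappa + eta) / (2 * mub) * eps d
                  + (mub ^+ 2 * kappa ^+ 2 + eta ^+ 2 + 2 * mub * kappa * eta)
                    / (8 * mub ^+ 2) * eps d ^+ 2)
        +o_ (0^'+) (fun d => eps d ^+ 2)].
Proof.
move=> eps mu mub kappa eta.
have u0 : 0 < mub := mu_bar_gt0 hm.
have [C [e0 [e00 wave]]] := wave_asymptotics hm hS.
rewrite -/mub -/kappa -/eta in wave.
pose q := eta / mub; pose D := `|kappa| + `|q| + 2.
have D0 : 0 < D by have := normr_ge0 kappa; have := normr_ge0 q; rewrite /D; lra.
pose a d := mub * Num.sqrt (eps d `^ (- m) / sigma d).
have small r k : 0 < r -> 0 < k -> \forall d \near 0^'+, eps d `^ r <= k.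
  exact: (family_eps_powR_small hm hfam).
have m0 : 0 < m by lra.
(* [wave_asymptotics] does not assert that its constant is nonnegative. *)
pose K := `|C|; have K0 : 0 <= K by apply: normr_ge0.
have CK d : C * eps d `^ m <= K * eps d `^ m.
  by apply: ler_wpM2r; rewrite ?powR_ge0 ?ler_norm.
have facts : \forall d \near 0^'+, [/\ 0 < d < 1 /\ 0 < eps d /\ eps d * D <= 4^-1,
    4^-1 <= a d /\ K * eps d `^ m <= 1,
    `|a d - (1 + eps d * (kappa - 1))| <= K * eps d `^ m,
    `|(1 - d) ^+ 2 - a d * (a d - eps d * (kappa + q))| <= K * eps d `^ m &
    mu d = mub * eps d * (a d)^-1 /\
    sigma d = mub ^+ 2 * eps d `^ (- m) * (a d ^+ 2)^-1].
  have e1 : 0 < Num.min e0 (4 * D)^-1 by rewrite lt_min e00 invr_gt0 mulr_gt0.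
  have K1 : 0 < K + 1 by lra.
  near=> d.
  have hd : 0 < d < 1 by near: d; exact: near_index.
  have /andP[eps0] : 0 < eps d <= Num.min e0 (4 * D)^-1.
    by near: d; exact: (family_eps_small hm hfam).
  rewrite le_min => /andP[ee0 eD].
  have [F [G [W hw]]] := family_primitives hm hfam hd.
  have [a4 aA NA] := wave _ _ _ _ _ _ _ hw ee0.
  split.
  - split => //; split => //; move: eD; rewrite invfM -ler_pdivrMr ?invr_gt0// invrK.
    by rewrite mulrC.
  - split => //.
    have : eps d `^ m <= (K + 1)^-1 by near: d; apply: small; rewrite ?invr_gt0.
    rewrite -[_^-1]mul1r ler_pdivlMr// => h.
    by have := powR_ge0 (eps d) m; lra.
  - exact: le_trans aA (CK d).
  - exact: le_trans NA (CK d).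
  - have s0 := sw_sigma_gt0 (hef_wave hfam hd).
    exact: mu_sigma_of_amplitude.
have powRD_gt0 d r s : 0 < eps d -> eps d `^ (r + s) = eps d `^ r * eps d `^ s.
  by move=> eps0; rewrite powRD// (gt_eqF eps0) implybT.
have mu_bound : \forall d \near 0^'+,
    `|mu d - mub * eps d / (1 + eps d * (kappa - 1))| <=
    mub * 8 * K * `|eps d `^ (m + 1)|.
  apply: filterS facts => d [[_ [eps0 eD]] [a4 _] aA _ [-> _]].
  have [_ _ /andP[A1 _] _] := small_parameters eps0 eD.
  rewrite -mulrBr normrM (gtr0_norm (mulr_gt0 u0 eps0)).
  rewrite (ger0_norm (powR_ge0 _ _)) powRD_gt0// powRr1 ?(ltW eps0)//.
  have := ler_wpM2l (ltW (mulr_gt0 u0 eps0)) (inv_close a4 A1 aA).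
  by move/le_trans; apply; lra.
(* Common form of the little-o remainders after division by the reference power: [r = m - 1] for
   [mu] and [sigma], and [r = m - 2] for [delta], whence the restriction [2 < m] there. *)
have vanish r c c' k : 0 < r -> 0 <= c -> 0 <= c' -> 0 < k ->
    \forall d \near 0^'+, c * eps d `^ r + c' * eps d <= k.
  move=> r0 c0 c'0 k0; pose B := c + c' + 1.
  have B0 : 0 < B by rewrite /B; lra.
  have kB : 0 < k / B by apply: divr_gt0.
  apply: filterS2 (small r _ r0 kB) (family_eps_small hm hfam kB) => d p1 /andP[_ p2].
  have := ler_wpM2l c0 p1; have := ler_wpM2l c'0 p2; rewrite -/eps.
  have kE : k = (c + c' + 1) * (k / B) by rewrite -/B mulrC divfK ?gt_eqF.
  by lra.
split.
- exact: bigO_of_bound mu_bound.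
- apply: (@bigO_of_bound _ _ _ _ _ (8 * K)).
  apply: filterS facts => d [[d01 [eps0 eD]] [a4 K1] aA NA _].
  rewrite (ger0_norm (powR_ge0 _ _)) -mulrA.
  by apply: norm_expansion => //; lra.
- apply: littleo_of_bound => k k0.
  have v := @vanish (m - 1) (mub * 8 * K) (2 * mub * (kappa - 1) ^+ 2) k
    ltac:(lra) (mulr_ge0 (mulr_ge0 (ltW u0) (ler0n _ _)) K0)
    (mulr_ge0 (mulr_ge0 (ler0n _ _) (ltW u0)) (sqr_ge0 _)) k0.
  apply: filterS3 facts mu_bound v => d [[d01 [eps0 eD]] _ _ _ _] mud vd.
  have [t4 _ _ _] := small_parameters eps0 eD.
  have h1 := ler_wpM2l (ltW (mulr_gt0 u0 eps0)) (inv_expansion t4).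
  have e2 : 0 <= eps d ^+ 2 by apply: sqr_ge0.
  have h2 := ler_wpM2l e2 vd.
  rewrite (ger0_norm (powR_ge0 _ _)) (_ : m + 1 = (1 + 1) + (m - 1)) in mud; last by ring.
  rewrite (powRD_gt0 d (1 + 1))// (powRD_gt0 d 1 1)// !powRr1 ?(ltW eps0)// in mud.
  rewrite (ger0_norm e2).
  set A := (1 + eps d * (kappa - 1))^-1 in mud h1.
  have -> : mu d - (mub * eps d + mub * (1 - kappa) * eps d ^+ 2) =
     (mu d - mub * eps d * A) + mub * eps d * (A - (1 - eps d * (kappa - 1))) by ring.
  apply: le_trans (ler_normD _ _) _.
  rewrite [X in _ + X <= _]normrM (gtr0_norm (mulr_gt0 u0 eps0)).
  by lra.
- apply: littleo_of_bound => k k0.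
  have u2 : 0 <= mub ^+ 2 by apply: sqr_ge0.
  have v := @vanish (m - 1) (mub ^+ 2 * 48 * K) (8 * mub ^+ 2 * (kappa - 1) ^+ 2) k
    ltac:(lra) (mulr_ge0 (mulr_ge0 u2 (ler0n _ _)) K0)
    (mulr_ge0 (mulr_ge0 (ler0n _ _) u2) (sqr_ge0 _)) k0.
  apply: filterS2 facts v => d [[d01 [eps0 eD]] [a4 _] aA _ [_ sE]] vd.
  have [t4 _ _ _] := small_parameters eps0 eD.
  have p0 := powR_ge0 (eps d) (- m).
  have h1 := ler_wpM2l (mulr_ge0 u2 p0) (inv_sqr_expansion t4 a4 aA).
  have h2 := ler_wpM2l (mulr_ge0 p0 (ltW eps0)) vd.
  rewrite (ger0_norm (powR_ge0 _ _)) powRD_gt0// powRr1 ?(ltW eps0)//.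
  rewrite sE (_ : _ - _ = mub ^+ 2 * eps d `^ (- m) *
    ((a d ^+ 2)^-1 - (1 - 2 * (eps d * (kappa - 1))))); last by ring.
  rewrite normrM (ger0_norm (mulr_ge0 u2 p0)); apply: le_trans h1 _.
  have em : eps d `^ m = eps d * eps d `^ (m - 1) by rewrite mulr_powRB1// ltW.
  by rewrite em; lra.
- move=> m2; apply: littleo_of_bound => k k0.
  have D30 : 0 <= D ^+ 3 by apply: exprn_ge0; exact: ltW.
  have v := @vanish (m - 2) (8 * K) (D ^+ 3) k ltac:(lra)
    (mulr_ge0 (ler0n _ _) K0) D30 k0.
  apply: filterS2 facts v => d [[d01 [eps0 eD]] [_ K1] aA NA _] vd.
  have e2 : 0 <= eps d ^+ 2 by apply: sqr_ge0.
  have d01' : 0 <= d <= 1 by lra.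
  have h1 := norm_expansion eps0 eD d01' K1 aA NA.
  have h2 := sqrt_expansion eps0 eD.
  have h3 := ler_wpM2l e2 vd.
  have em : eps d `^ m = eps d ^+ 2 * eps d `^ (m - 2).
    rewrite {1}(_ : m = (1 + 1) + (m - 2)); last by ring.
    by rewrite (powRD_gt0 d (1 + 1))// (powRD_gt0 d 1 1)// !powRr1 ?(ltW eps0)// -expr2.
  rewrite em in h1; rewrite (ger0_norm e2); set s := Num.sqrt _ in h1 h2.
  have -> : d - ((2 * mub - mub * kappa + eta) / (2 * mub) * eps d +
      (mub ^+ 2 * kappa ^+ 2 + eta ^+ 2 + 2 * mub * kappa * eta) / (8 * mub ^+ 2)
        * eps d ^+ 2) =
      (d - (1 - s)) - (s - (1 - ((2 - kappa + q) / 2 * eps d +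
        (kappa + q) ^+ 2 / 8 * eps d ^+ 2))).
    by rewrite /q; field; rewrite gt_eqF.
  apply: le_trans (ler_normB _ _) _; rewrite -/D in h2.
  by lra.
Unshelve. all: by end_near. Qed.
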